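(* Let $\mathcal{G}$ be the compact graph with two vertices $v_1,v_2$ and three edges of length $2\pi$, each joining $v_1$ to $v_2$, with Hamiltonian $H_0=-\partial_x^2$ and Neumann--Kirchhoff conditions at both vertices. The eigenvalues of $H_0$ and the corresponding eigenfunctions (spanning the eigenspaces) are given by $\lambda_0=0$, $\phi_0=1$ and, for $k\ge1$, $\lambda_k=\left(\frac{k}{2}\right)^2$, of multiplicity three, with $$\phi_{k,1}=\big(c_{\frac k2},c_{\frac k2},c_{\frac k2}\big),\quad\phi_{k,2}=\big(-s_{\frac k2},s_{\frac k2},0\big),\quad\phi_{k,3}=\big(-s_{\frac k2},0,s_{\frac k2}\big).$$
   Context: For $\lambda\in\mathbb{R}$ and $x\in[0,2\pi]$: $c_\lambda(x)=\cos(\lambda x)$, $s_\lambda(x)=\sin(\lambda x)$. Each edge is parameterized by $[0,2\pi]$, oriented from $v_1$ (coordinate $0$) to $v_2$ (coordinate $2\pi$). Functions on $\mathcal{G}$ are triples $f=(f^1,f^2,f^3)$ of complex-valued functions on $[0,2\pi]$, and $L^2(\mathcal{G})=\bigoplus_{j=1}^3L^2(0,2\pi)$. The domain of $H_0=-\partial_x^2$ is the set of $f$ with $f^j\in H^2(0,2\pi)$, $f^1(0)=f^2(0)=f^3(0)$, $f^1(2\pi)=f^2(2\pi)=f^3(2\pi)$, $\sum_{j=1}^3\partial_xf^j(0)=0$ and $\sum_{j=1}^3\partial_xf^j(2\pi)=0$. *)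

(* Defs.v *)
From mathcomp Require Import all_boot all_order all_algebra.
From mathcomp Require Import all_classical all_reals all_analysis.
From mathcomp Require Import complex.

Set Implicit Arguments.
Unset Strict Implicit.
Unset Printing Implicit Defensive.

Import Order.TTheory GRing.Theory Num.Theory.
Import numFieldNormedType.Exports.
Local Open Scope classical_set_scope.
Local Open Scope ring_scope.
Local Open Scope complex_scope.

(* A function on an edge is a function R -> R[i] of which only the values on
   [0, 2 pi] matter. Elements of L^2 are represented by such functions, Borel
   measurable on ]0, 2 pi[ and considered up to equality almost everywhere on
   ]0, 2 pi[; the values at the endpoints carry no information. Being in H^2,
   in the domain of H_0 or in an eigenspace only depends on the class. *)
Section Edge.
Variable R : realType.
Implicit Types (u v g h : R -> R[i]) (phi : R -> R) (n : nat).

Definition edge : set R := `]0, 2 * pi[%classic.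
Definition cedge : set R := `[0, 2 * pi]%classic.

Definition cintegral (D : set R) u : R[i] :=
  (\int[@lebesgue_measure R]_(x in D) complex.Re (u x)) +i*
  (\int[@lebesgue_measure R]_(x in D) complex.Im (u x)).

Definition in_L2 u : Prop :=
  [/\ measurable_fun edge (fun x => complex.Re (u x)),
      measurable_fun edge (fun x => complex.Im (u x)) &
      (\int[@lebesgue_measure R]_(x in edge)
         (complex.Re (u x) ^+ 2 + complex.Im (u x) ^+ 2)%:E < +oo)%E].

Definition eq_L2 u v : Prop := ae_eq (@lebesgue_measure R) edge u v.

Definition test_function phi : Prop :=
  [/\ forall n (x : R), derivable (derive1n n phi) x 1,
      compact (closure [set x | phi x != 0]) &
      closure [set x | phi x != 0] `<=` edge].

Definition weak_derivative n u g : Prop :=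
  forall phi, test_function phi ->
    cintegral edge (fun x => u x * (derive1n n phi x)%:C) =
    (-1) ^+ n * cintegral edge (fun x => g x * (phi x)%:C).

Definition in_H2 u : Prop :=
  in_L2 u /\
  exists g h, [/\ in_L2 g, in_L2 h,
                  weak_derivative 1 u g & weak_derivative 2 u h].

Definition continuous_on_cedge u : Prop :=
  {within cedge, continuous (fun x => complex.Re (u x))} /\
  {within cedge, continuous (fun x => complex.Im (u x))}.

End Edge.

Section Graph.
Variable R : realType.

Definition graph_function : Type := 'I_3 -> R -> R[i].

Implicit Types (f h : graph_function) (l : R[i]) (n k : nat).

Definition in_L2G f : Prop := forall j, in_L2 (f j).
Definition eq_L2G f h : Prop := forall j, eq_L2 (f j) (h j).

(* The boundary values f^j(v) and (f^j)'(v) of an H^2 function are those of the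
   continuous representatives F^j of f^j and G^j of its weak derivative. *)
Definition domain_H0 f : Prop :=
  (forall j, in_H2 (f j)) /\
  exists F G : graph_function,
    [/\ forall j, continuous_on_cedge (F j) /\ eq_L2 (f j) (F j),
        forall j, continuous_on_cedge (G j) /\ weak_derivative 1 (f j) (G j),
        forall i j, F i 0 = F j 0 /\ F i (2 * pi) = F j (2 * pi),
        \sum_(j < 3) G j 0 = 0 &
        \sum_(j < 3) G j (2 * pi) = 0].

(* The graph of the unbounded operator H_0 on L^2(G), i.e. H_0 f = h. *)
Definition H0 f h : Prop :=
  [/\ domain_H0 f, in_L2G h &
      forall j, weak_derivative 2 (f j) (fun x => - h j x)].

Definition eigenspace_H0 l f : Prop := H0 f (fun j x => l * f j x).

Definition eigenvalue_H0 l : Prop :=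
  exists f, eigenspace_H0 l f /\ ~ eq_L2G f (fun _ _ => 0).

Definition lincomb n (a : 'I_n -> R[i]) (b : 'I_n -> graph_function) :
    graph_function :=
  fun j x => \sum_(i < n) a i * b i j x.

Definition eigenbasis_H0 l n (b : 'I_n -> graph_function) : Prop :=
  [/\ forall i, eigenspace_H0 l (b i),
      forall a : 'I_n -> R[i],
        eq_L2G (lincomb a b) (fun _ _ => 0) -> forall i, a i = 0 &
      forall f, eigenspace_H0 l f ->
        exists a : 'I_n -> R[i], eq_L2G f (lincomb a b)].

Definition multiplicity_H0 l n : Prop :=
  exists b : 'I_n -> graph_function, eigenbasis_H0 l b.

Definition c_ (l x : R) : R[i] := (cos (l * x))%:C.
Definition s_ (l x : R) : R[i] := (sin (l * x))%:C.

Definition triple (f1 f2 f3 : R -> R[i]) : graph_function :=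
  fun j => tnth [tuple f1; f2; f3] j.

Definition lambda k : R[i] := ((k%:R / 2) ^+ 2 : R)%:C.

Definition phi0 : graph_function := fun _ _ => 1.
Definition phi1 k : graph_function :=
  triple (c_ (k%:R / 2)) (c_ (k%:R / 2)) (c_ (k%:R / 2)).
Definition phi2 k : graph_function :=
  triple (fun x => - s_ (k%:R / 2) x) (s_ (k%:R / 2)) (fun=> 0).
Definition phi3 k : graph_function :=
  triple (fun x => - s_ (k%:R / 2) x) (fun=> 0) (s_ (k%:R / 2)).

End Graph.

Arguments phi0 R : clear implicits.
Arguments phi1 R k : clear implicits.
Arguments phi2 R k : clear implicits.
Arguments phi3 R k : clear implicits.

(* Main.v *)
Require Import Defs.
From mathcomp Require Import all_boot all_order all_algebra.
From mathcomp Require Import all_classical all_reals all_analysis.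
From mathcomp Require Import complex measurable_realfun.
From mathcomp Require Import ring lra.

(** The proof has an analytic half and an elementary half.

    The analytic half turns eigenfunctions, which are defined by weak
    derivatives tested against smooth functions of compact support, into
    classical solutions of an ordinary differential equation. The key is the du
    Bois-Reymond lemma ([weak_derivative0_cst]): a continuous function with zero
    weak derivative is constant. It needs test functions whose derivative is
    concentrated near two chosen points; they are differences of two smooth
    ramps, built from e^(-1/x). Subtracting a primitive, a continuous function
    with a continuous weak derivative is classically derivable
    ([weak_derivative_derivative]). Applied to the continuous representatives of
    an eigenfunction and of its derivative, this gives the real first-order
    system recorded in [graph_solution].

    In the elementary half the self-adjointness of H_0 appears through two
    functions on [0, 2 pi], sums over the edges, that vanish at both ends by the
    Kirchhoff conditions; their derivative must vanish as soon as it has constant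
    sign. For the Wronskian of the real and imaginary parts the sign is always
    constant, so the eigenvalue is real ([graph_solution_imaginary]). For the
    product of the function with its derivative it is constant when the
    eigenvalue is at most 0, which excludes negative eigenvalues and leaves only
    the constants for the eigenvalue 0 ([graph_solution_energy]). For an eigenvalue m^2 > 0 the solution on edge j
    is al cos (m x) + be_j sin (m x) with the be_j of zero sum, and the
    conditions at the second vertex allow a nonzero solution only if
    sin (2 pi m) = 0, that is m = k / 2 ([kirchhoff_oscillators]). Then al and
    the be_j are otherwise free, which leaves dimension 1 + 2 = 3. Conversely
    integration by parts shows that these functions are eigenfunctions
    ([trig_function_eigenspace]). *)

Set Implicit Arguments.
Unset Strict Implicit.
Unset Printing Implicit Defensive.

Import Order.TTheory GRing.Theory Num.Theory.
Import numFieldNormedType.Exports.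
Local Open Scope classical_set_scope.
Local Open Scope ring_scope.
Local Open Scope complex_scope.

Local Notation "f ^` ()" := (derive1 f) : ring_scope.

(** * Derivatives of real functions *)
Section RealDerivatives.
Variable R : realType.
Implicit Types (f g : R -> R) (x a b c : R).

(** Fixing the normed-module structure of the real line once makes the
    differentiation rules below apply to plain real expressions, with no
    conversion between multiplication and scaling. *)
Definition has_derive f x a : Prop := is_derive (x : R) (1 : R) f a.

Lemma has_deriveE f x a : has_derive f x a -> f^`() x = a.
Proof. by move=> fa; rewrite derive1E; case: fa. Qed.

Lemma has_derive_derivable f x a : has_derive f x a -> derivable f x 1.
Proof. by case. Qed.

Lemma derivable_has_derive f x : derivable f x 1 -> has_derive f x (f^`() x).
Proof. by move=> fD; rewrite /has_derive derive1E; exact: derivableP. Qed.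

Lemma has_derive_eq f x a b : has_derive f x a -> a = b -> has_derive f x b.
Proof. by move=> ? <-. Qed.

Lemma has_derive_cst c x : has_derive (fun=> c) x (0 : R).
Proof. exact: is_derive_cst. Qed.

Lemma has_derive_id x : has_derive (fun y : R => y) x (1 : R).
Proof. exact: is_derive_id. Qed.

Lemma has_deriveN f x a :
  has_derive f x a -> has_derive (fun y => - f y) x (- a).
Proof. by move=> fa; exact: (is_deriveN fa). Qed.

Lemma has_deriveD f g x a b : has_derive f x a -> has_derive g x b ->
  has_derive (fun y => f y + g y) x (a + b).
Proof. by move=> fa gb; exact: (is_deriveD fa gb). Qed.

Lemma has_deriveB f g x a b : has_derive f x a -> has_derive g x b ->
  has_derive (fun y => f y - g y) x (a - b).
Proof. by move=> fa gb; exact: (is_deriveB fa gb). Qed.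

Lemma has_deriveM f g x a b : has_derive f x a -> has_derive g x b ->
  has_derive (fun y => f y * g y) x (f x * b + g x * a).
Proof. by move=> fa gb; exact: (is_deriveM fa gb). Qed.

Lemma has_deriveZ c f x a :
  has_derive f x a -> has_derive (fun y => c * f y) x (c * a).
Proof. by move=> fa; exact: (is_deriveZ c fa). Qed.

Lemma has_deriveV f x a : f x != 0 -> has_derive f x a ->
  has_derive (fun y => (f y)^-1) x (- (f x)^-1 ^+ 2 * a).
Proof. by move=> fx0 fa; rewrite exprVn; exact: (is_deriveV fx0 fa). Qed.

Lemma has_derive_comp f g x a b : has_derive f (g x) a -> has_derive g x b ->
  has_derive (fun y => f (g y)) x (a * b).
Proof. exact: is_derive1_comp. Qed.

Lemma has_derive_near f g x a :
  (\near x, f x = g x) -> has_derive f x a -> has_derive g x a.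
Proof. by move=> fg fa; exact: near_eq_is_derive fa. Qed.

Lemma has_derive_affine f c b x a : has_derive f (c * x + b) a ->
  has_derive (fun y => f (c * y + b)) x (c * a).
Proof.
move=> fa; apply: has_derive_eq (mulrC _ _).
apply: (has_derive_comp (g := fun y => c * y + b)) => //.
apply: has_derive_eq.
  exact: has_deriveD (has_deriveZ c (has_derive_id x)) (has_derive_cst b x).
by rewrite mulr1 addr0.
Qed.

End RealDerivatives.

(** * Smooth functions and a smooth step *)
Section Smooth.
Variable R : realType.
Implicit Types (f g : R -> R) (x c : R).

(** [n] derivatives exist at every point. This recursion peels off the
    innermost derivative, which is what lets the closure properties be proved
    by induction on [n]; [CkP] links it with iterated derivatives. *)
Fixpoint Ck n f : Prop :=
  if n is m.+1 then (forall x, derivable f x 1) /\ Ck m f^`() else True.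

Lemma CkP f : (forall n, Ck n f) <-> forall n x, derivable (derive1n n f) x 1.
Proof.
split=> [fC n|fD n].
  elim: n f fC => [|n IHn] f fC; first exact: (fC 1%N).1.
  by rewrite derive1Sn; apply: IHn => k; exact: (fC k.+1).2.
elim: n f fD => [//|n IHn] f fD; split; first exact: (fD 0%N).
by apply: IHn => k; rewrite -derive1Sn.
Qed.

Lemma has_derive_fun f g : (forall x : R, has_derive f x (g x)) -> f^`() = g.
Proof. by move=> fg; apply/funext => x; exact: has_deriveE. Qed.

Lemma CkS_has_derive n f g :
  (forall x : R, has_derive f x (g x)) -> Ck n g -> Ck n.+1 f.
Proof.
move=> fg gC; split; first by move=> x; case: (fg x).
by rewrite (has_derive_fun fg).
Qed.

Lemma Ck_has_derive n f x : Ck n.+1 f -> has_derive f x (f^`() x).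
Proof. by move=> [fD _]; exact: derivable_has_derive. Qed.

Lemma CkW n f : Ck n.+1 f -> Ck n f.
Proof. by elim: n f => [//|n IHn] f [fD /IHn]. Qed.

Lemma Ck_cst n (c : R) : Ck n (cst c).
Proof.
elim: n c => [//|n IHn] c.
exact: (@CkS_has_derive _ _ (cst 0) (fun x => has_derive_cst c x)).
Qed.

Lemma CkD n f g : Ck n f -> Ck n g -> Ck n (fun x => f x + g x).
Proof.
elim: n f g => [//|n IHn] f g fC gC.
apply: (@CkS_has_derive n _ (fun x => f^`() x + g^`() x)) => [x|].
  exact: has_deriveD (Ck_has_derive x fC) (Ck_has_derive x gC).
by apply: IHn; [case: fC|case: gC].
Qed.

Lemma CkM n f g : Ck n f -> Ck n g -> Ck n (fun x => f x * g x).
Proof.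
elim: n f g => [//|n IHn] f g fC gC.
apply: (@CkS_has_derive n _ (fun x => f x * g^`() x + g x * f^`() x)) => [x|].
  exact: has_deriveM (Ck_has_derive x fC) (Ck_has_derive x gC).
by apply: CkD; apply: IHn; [exact: CkW|case: gC|exact: CkW|case: fC].
Qed.

Lemma CkZ n c f : Ck n f -> Ck n (fun x => c * f x).
Proof. by move=> fC; apply: CkM => //; exact: Ck_cst. Qed.

Lemma CkV n f : (forall x, f x != 0) -> Ck n f -> Ck n (fun x => (f x)^-1).
Proof.
move=> f0; elim: n => [//|n IHn] fC.
have VC : Ck n (fun x => (f x)^-1) by apply: IHn; exact: CkW.
apply: (@CkS_has_derive n _ (fun x => - (f x)^-1 ^+ 2 * f^`() x)) => [x|].
  exact: has_deriveV (f0 x) (Ck_has_derive x fC).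
apply: CkM; last by case: fC.
rewrite (_ : (fun x => _) = fun x => -1 * ((f x)^-1 * (f x)^-1)).
  by apply: CkZ; exact: CkM.
by apply/funext => x; rewrite mulN1r expr2.
Qed.

Lemma Ck_affine n f (c d : R) : Ck n f -> Ck n (fun x => f (c * x + d)).
Proof.
elim: n f => [//|n IHn] f fC.
apply: (@CkS_has_derive n _ (fun x => c * f^`() (c * x + d))) => [x|].
  exact: has_derive_affine (Ck_has_derive _ fC).
by apply: CkZ; apply: IHn; case: fC.
Qed.

(** The functions x^-k e^(-1/x), extended by 0 to x <= 0. Deriving one of them
    gives a combination of two others, so the whole family is smooth at once. *)
Definition flat k (x : R) : R := if 0 < x then x^-1 ^+ k * expR (- x^-1) else 0.

Lemma flat_le0 k x : x <= 0 -> flat k x = 0.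
Proof. by rewrite /flat ltNge => ->. Qed.

Lemma flat_ge0 k x : 0 <= flat k x.
Proof.
rewrite /flat; case: ifP => // x0.
by rewrite mulr_ge0 ?expR_ge0 ?exprn_ge0 ?invr_ge0 ?ltW.
Qed.

Lemma flat_gt0 k x : 0 < x -> 0 < flat k x.
Proof. by move=> x0; rewrite /flat x0 mulr_gt0 ?expR_gt0 ?exprn_gt0 ?invr_gt0. Qed.

Lemma flatS k x : flat k x = x * flat k.+1 x.
Proof.
rewrite /flat; case: ifP => x0; last by rewrite mulr0.
by rewrite exprS !mulrA mulfV ?mul1r// gt_eqF.
Qed.

(** With y = 1/x, the exponential series gives e^y >= y^(k+1) / (k+1)!. Hence
    continuity at 0 for every [k]; by [flatS], continuity of [flat k.+1] at 0
    amounts to a zero derivative of [flat k] there. *)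
Lemma flat_bound k x : `|flat k x| <= (k.+1)`!%:R * `|x|.
Proof.
rewrite ger0_norm ?flat_ge0//.
have [x0|x0] := leP x 0; first by rewrite flat_le0// mulr_ge0.
rewrite /flat x0 gtr0_norm// expRN ler_pdivrMr ?expR_gt0//.
have y0 : 0 < x^-1 by rewrite invr_gt0.
have := expR_ge1Dxn k (ltW y0).
set F := (_`!%:R); set E := expR _ => h.
have F0 : 0 < F by rewrite ltr0n fact_gt0.
have {h} : x^-1 ^+ k.+1 / F <= E by apply: le_trans h; rewrite lerDr.
rewrite ler_pdivrMr// => h.
rewrite [leLHS](_ : _ = x * x^-1 ^+ k.+1); last first.
  by rewrite exprS mulrA mulfV ?mul1r// gt_eqF.
by rewrite [leRHS](_ : _ = x * (E * F)) ?ler_pM2l//; ring.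
Qed.

Lemma flat_continuous0 k : {for 0, continuous (flat k)}.
Proof.
rewrite /prop_for /continuous_at flat_le0//.
apply/cvgr0Pnorm_le => e e0; near=> x.
apply: le_trans (flat_bound _ _) _.
rewrite -ler_pdivlMl ?ltr0n ?fact_gt0//.
near: x; apply: (@cvgr0_norm_le _ R^o R (nbhs 0) _ id) => //.
by rewrite mulr_gt0 ?invr_gt0 ?ltr0n ?fact_gt0.
Unshelve. all: by end_near. Qed.

Lemma has_derive_flat k x :
  has_derive (flat k) x (- k%:R * flat k.+1 x + flat k.+2 x).
Proof.
have [x0|x0|->] := ltgtP x 0.
- rewrite !flat_le0 ?(ltW x0)// mulr0 addr0.
  apply: (@has_derive_near _ (fun=> 0)); last exact: has_derive_cst.
  by near=> y; rewrite /= flat_le0//; apply/ltW; near: y; exact: lt_nbhsl.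
- apply: (@has_derive_near _ (fun y : R => y^-1 ^+ k * expR (- y^-1) : R)) => //.
    by near=> y; rewrite /flat ifT//; near: y; exact: lt_nbhsr.
  have x0' : x != 0 by rewrite gt_eqF.
  have DV := has_deriveV (f := id) x0' (has_derive_id x).
  have DX : has_derive (fun y : R => y^-1 ^+ k) x (- k%:R * x^-1 ^+ k.+1).
    elim: k => [|k IHk]; first by rewrite oppr0 mul0r; exact: has_derive_cst.
    rewrite (_ : (fun y : R => _) = (fun y : R => y^-1 * y^-1 ^+ k)); last first.
      by apply/funext => y; rewrite exprS.
    by apply: has_derive_eq; [exact: (has_deriveM DV IHk)|rewrite -natr1 !exprS /=; ring].
  have DE := has_derive_comp (is_derive_expR _) (has_deriveN DV).
  apply: has_derive_eq; first exact: (has_deriveM DX DE).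
  by rewrite /flat x0 !exprS /=; ring.
- rewrite !flat_le0// mulr0 addr0.
  apply/is_derive1_caratheodory; exists (flat k.+1); split.
  + by move=> z; rewrite (@flat_le0 k 0)// !subr0 mulrC -flatS.
  + exact: flat_continuous0.
  + by rewrite flat_le0.
Unshelve. all: by end_near. Qed.

Lemma Ck_flat n k : Ck n (flat k).
Proof.
elim: n k => [//|n IHn] k; apply: CkS_has_derive (has_derive_flat k) _.
by apply: CkD => //; apply: CkM => //; exact: Ck_cst.
Qed.

(** Smooth and nondecreasing, 0 on the left of 0 and 1 on the right of 1. *)
Definition step (x : R) : R := flat 0 x / (flat 0 x + flat 0 (1 - x)).

Lemma step_den_gt0 x : 0 < flat 0 x + flat 0 (1 - x).
Proof.
have [x0|x0] := leP x 0; last by rewrite ltr_wpDr ?flat_ge0 ?flat_gt0.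
by rewrite ltr_wpDl ?flat_ge0// flat_gt0// subr_gt0; lra.
Qed.

Lemma step_le0 x : x <= 0 -> step x = 0.
Proof. by move=> x0; rewrite /step flat_le0// mul0r. Qed.

Lemma step_ge1 x : 1 <= x -> step x = 1.
Proof.
move=> x1; rewrite /step (@flat_le0 _ (1 - x)) ?subr_le0// addr0 divff//.
by rewrite gt_eqF// flat_gt0//; lra.
Qed.

Let flat_onem n k : Ck n (fun x => flat k (1 - x)).
Proof.
rewrite (_ : (fun x => _) = fun x => flat k (-1 * x + 1)); last first.
  by apply/funext => x; congr flat; ring.
exact/Ck_affine/Ck_flat.
Qed.

Lemma Ck_step n : Ck n step.
Proof.
apply: CkM; first exact: Ck_flat.
apply: CkV; first by move=> x; rewrite gt_eqF// step_den_gt0.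
by apply: CkD; [exact: Ck_flat|exact: flat_onem].
Qed.

(** With h = [flat 0] and k(x) = h(1 - x), the derivative of h / (h + k) is
    (h' k - h k') / (h + k)^2, where h' >= 0 and k' <= 0. *)
Lemma step_deriv_ge0 x : 0 <= step^`() x.
Proof.
pose h := flat 0; pose k x := flat 0 (1 - x).
have Dh : has_derive h x (flat 2 x).
  by apply: has_derive_eq; [exact: has_derive_flat|rewrite mulNr mul0r oppr0 add0r].
have Dk : has_derive k x (- flat 2 (1 - x)).
  apply: has_derive_eq.
    apply: has_derive_comp; first exact: has_derive_flat.
    exact: has_deriveB (has_derive_cst 1 x) (has_derive_id x).
  by rewrite sub0r mulrN1 mulNr mul0r oppr0 add0r.
have d0 : h x + k x != 0 by rewrite gt_eqF// step_den_gt0.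
have D := has_deriveM Dh (has_deriveV (f := fun y => h y + k y) d0 (has_deriveD Dh Dk)).
rewrite (has_deriveE (f := step) D).
rewrite [leRHS](_ : _ = (h x + k x)^-1 ^+ 2 * (h x * flat 2 (1 - x) + k x * flat 2 x)).
  by rewrite mulr_ge0 ?sqr_ge0// addr_ge0// mulr_ge0 ?flat_ge0.
by field.
Qed.

End Smooth.

(** * Calculus on a segment *)
Section Segment.
Variable R : realType.
Variables a b : R.
Hypothesis ab : a < b.
Implicit Types (u f g : R -> R) (x c : R).
Local Notation mu := (@lebesgue_measure R).

Definition segment_continuous f := {within `[a, b], continuous f}.

Lemma segment_continuous_cst c : segment_continuous (fun=> c).
Proof. by apply: continuous_subspaceT => x; exact: cvg_cst. Qed.

Lemma segment_continuousN f :
  segment_continuous f -> segment_continuous (fun x => - f x).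
Proof. by move=> cf z; apply: continuousN; exact: cf. Qed.

Lemma segment_continuousD f g : segment_continuous f -> segment_continuous g ->
  segment_continuous (fun x => f x + g x).
Proof. by move=> cf cg z; apply: continuousD; [exact: cf|exact: cg]. Qed.

Lemma segment_continuousM f g : segment_continuous f -> segment_continuous g ->
  segment_continuous (fun x => f x * g x).
Proof. by move=> cf cg z; apply: continuousM; [exact: cf|exact: cg]. Qed.

Lemma segment_continuousB f g : segment_continuous f -> segment_continuous g ->
  segment_continuous (fun x => f x - g x).
Proof. by move=> cf cg; apply: segment_continuousD => //; exact: segment_continuousN. Qed.

Lemma segment_continuousZ c f :
  segment_continuous f -> segment_continuous (fun x => c * f x).
Proof. by apply: segment_continuousM; exact: segment_continuous_cst. Qed.

Lemma derivable_segment_continuous f :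
  (forall x, derivable f x 1) -> segment_continuous f.
Proof. by move=> fD; apply: derivable_within_continuous => x _; exact: fD. Qed.

Lemma integrable_segment f : segment_continuous f ->
  mu.-integrable `[a, b] (EFin \o f).
Proof. by apply: continuous_compact_integrable; exact: segment_compact. Qed.

Lemma integrable_open_segment f : segment_continuous f ->
  mu.-integrable `]a, b[ (EFin \o f).
Proof.
move=> /integrable_segment; apply: integrableS => //.
exact: subset_itv_oo_cc.
Qed.

Lemma Rintegral_open_segment f : segment_continuous f ->
  \int[mu]_(x in `]a, b[) f x = \int[mu]_(x in `[a, b]) f x.
Proof.
move=> cf; rewrite Rintegral_itv_obnd_cbnd; last exact: integrable_open_segment.
rewrite Rintegral_itv_bndo_bndc//; apply: integrableS (integrable_segment cf) => //.
exact: subset_itv_co_cc.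
Qed.

Lemma derivable_oo_LRcontinuousP u : segment_continuous u ->
  (forall x, x \in `]a, b[ -> derivable u x 1) -> derivable_oo_LRcontinuous u a b.
Proof. by move=> /(continuous_within_itvP _ ab)[_ ua ub] uD; split. Qed.

Lemma Rintegral_derivative u g : segment_continuous u -> segment_continuous g ->
  (forall x, x \in `]a, b[ -> has_derive u x (g x)) ->
  \int[mu]_(x in `]a, b[) g x = u b - u a.
Proof.
move=> cu cg ug; rewrite Rintegral_open_segment// /Rintegral.
rewrite (@continuous_FTC2 _ g u)//.
  apply: derivable_oo_LRcontinuousP => // x xab.
  exact: has_derive_derivable (ug _ xab).
by move=> x xab; exact: has_deriveE (ug _ xab).
Qed.

(** The primitive is the integral from [a]: it is derivable only inside the
    segment, since [g] says nothing outside, but continuous up to its ends. *)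
Lemma primitive_exists g : segment_continuous g ->
  exists2 P, segment_continuous P &
    forall x, x \in `]a, b[ -> has_derive P x (g x).
Proof.
move=> cg; exists (fun x => \int[mu]_(t in `[a, x]) g t).
  by apply: (parameterized_integral_continuous (ltW ab)); exact: integrable_segment.
move=> x xab; have := xab; rewrite in_itv /= => /andP[ax xb].
have [cgx _ _] := (continuous_within_itvP _ ab).1 cg.
have [PD PE] := continuous_FTC1_closed xb (integrable_segment cg) ax (cgx _ xab).
by rewrite -PE; exact: derivable_has_derive.
Qed.

Lemma zero_derivative_cst u : segment_continuous u ->
  (forall x, x \in `]a, b[ -> has_derive u x 0) ->
  forall x, x \in `[a, b] -> u x = u a.
Proof.
move=> cu u0 x; rewrite in_itv /= => /andP[ax xb].
have [||c _] := @MVT_segment _ u (fun=> 0) a x ax.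
- move=> y; rewrite in_itv /= => /andP[ay yx]; apply: u0.
  by rewrite in_itv /= ay (lt_le_trans yx).
- by apply: continuous_subspaceW cu; exact: subset_itvl.
- by rewrite mul0r => /eqP; rewrite subr_eq0 => /eqP.
Qed.

(** A nondecreasing function with equal values at both ends is constant. This
    replaces integration in the Wronskian and energy arguments below. *)
Lemma ge0_derivative_eq0 u g : segment_continuous u ->
  (forall x, x \in `]a, b[ -> has_derive u x (g x)) ->
  (forall x, x \in `]a, b[ -> 0 <= g x) -> u a = u b ->
  forall x, x \in `]a, b[ -> g x = 0.
Proof.
move=> cu ug g0 uab x xab.
have uD y : y \in `]a, b[ -> derivable u y 1.
  by move=> yab; exact: has_derive_derivable (ug _ yab).
have u0 y : y \in `]a, b[ -> 0 <= u^`() y.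
  by move=> yab; rewrite (has_deriveE (ug _ yab)); exact: g0.
have mono := ger0_derive1_ndecr uD u0 cu.
have ucst y : y \in `]a, b[ -> u y = u a.
  rewrite in_itv /= => /andP[/ltW ay /ltW yb]; apply/eqP; rewrite eq_le.
  by rewrite [X in _ && X]mono//= uab mono.
rewrite -(has_deriveE (ug _ xab)).
apply/has_deriveE/(@has_derive_near _ (fun=> u a)); last exact: has_derive_cst.
have := xab; rewrite in_itv /= => /andP[ax xb].
near=> y; rewrite ucst// in_itv /=; apply/andP; split; near: y.
  exact: lt_nbhsr.
exact: lt_nbhsl.
Unshelve. all: by end_near. Qed.

(** A nonzero value inside the segment would persist on a ball, which has
    positive measure. The ends follow because the function, being zero inside,
    has zero derivative there and is thus constant on the closed segment. *)
Lemma segment_continuous_eq0 f : segment_continuous f ->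
  ae_eq mu `]a, b[%classic f (fun=> 0) -> forall x, x \in `[a, b] -> f x = 0.
Proof.
move=> cf f0 x xab.
have f0o y : y \in `]a, b[ -> f y = 0.
  move=> yab; apply: contrapT => /eqP fy0.
  have [cfo _ _] := (continuous_within_itvP _ ab).1 cf.
  have := cfo _ yab => /cvgr_neq0 /(_ fy0) nz.
  have ny : nbhs y `]a, b[%classic.
    apply: open_nbhs_nbhs; split; first exact: interval_open.
    exact: yab.
  have [e /= e0 eS] := (nbhs_ballP _ _).1 (filterI nz ny).
  move: f0 => [A [mA A0 SA]].
  have : (mu (ball y e) <= mu A)%E.
    apply: le_measure; rewrite ?inE//; first exact: measurable_realfun.measurable_ball.
    apply: subset_trans SA => z /eS[/= fz zab] H; move/eqP: fz; apply; exact: H.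
  rewrite A0 (lebesgue_measure_ball _ (ltW e0)) leNgt lte_fin.
  by rewrite mulrn_wgt0.
have D0 y : y \in `]a, b[ -> has_derive f y 0.
  move=> yab; apply: (@has_derive_near _ (fun=> 0)); last exact: has_derive_cst.
  have := yab; rewrite in_itv /= => /andP[ay yb].
  near=> z; rewrite f0o// in_itv /=; apply/andP; split; near: z.
    exact: lt_nbhsr.
  exact: lt_nbhsl.
rewrite (zero_derivative_cst cf D0 xab) -(zero_derivative_cst cf D0 (x := (a + b) / 2)).
  by apply: f0o; rewrite in_itv /= !midf_lt.
by rewrite in_itv /= !ltW ?midf_lt.
Unshelve. all: by end_near. Qed.

End Segment.

(** * Localised averages *)
Section Ramp.
Variable R : realType.
Implicit Types (u : R -> R) (c e x : R).
Local Notation mu := (@lebesgue_measure R).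

(** A smooth transition from 0 at [c] to 1 at [c + e]: for e > 0 its derivative
    is a nonnegative bump of integral 1 located just after [c]. *)
Definition ramp c e x : R := step (e^-1 * x - e^-1 * c).

Lemma Ck_ramp n c e : Ck n (ramp c e).
Proof. exact: (@Ck_affine _ n _ e^-1 (- (e^-1 * c)) (Ck_step R n)). Qed.

Lemma has_derive_ramp c e x : has_derive (ramp c e) x ((ramp c e)^`() x).
Proof. exact: Ck_has_derive (Ck_ramp 1 c e). Qed.

Lemma ramp_le c e x : 0 < e -> x <= c -> ramp c e x = 0.
Proof.
move=> e0 xc; apply: step_le0.
by rewrite -mulrBr mulr_ge0_le0 ?invr_ge0 ?subr_le0// ltW.
Qed.

Lemma ramp_ge c e x : 0 < e -> c + e <= x -> ramp c e x = 1.
Proof.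
move=> e0 xc; apply: step_ge1.
by rewrite -mulrBr ler_pdivlMl// mulr1 lerBrDl.
Qed.

Lemma ramp_deriv_ge0 c e x : 0 < e -> 0 <= (ramp c e)^`() x.
Proof.
move=> e0; have D := has_derive_affine (f := @step R) (c := e^-1) (b := - (e^-1 * c)) (x := x)
  (Ck_has_derive _ (Ck_step R 1)).
by rewrite (has_deriveE (f := ramp c e) D) mulr_ge0 ?step_deriv_ge0// invr_ge0 ltW.
Qed.

Lemma ramp_deriv_eq0 c e x : 0 < e -> ~~ (c <= x <= c + e) -> (ramp c e)^`() x = 0.
Proof.
move=> e0; rewrite negb_and -!ltNge => /orP[xc|xc]; apply: has_deriveE.
  apply: (@has_derive_near _ (fun=> 0)); last exact: has_derive_cst.
  by near=> y; rewrite ramp_le//; apply/ltW; near: y; exact: lt_nbhsl.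
apply: (@has_derive_near _ (fun=> 1)); last exact: has_derive_cst.
by near=> y; rewrite ramp_ge//; apply/ltW; near: y; exact: lt_nbhsr.
Unshelve. all: by end_near. Qed.

Lemma ramp_deriv_continuous a b c e : segment_continuous a b (ramp c e)^`().
Proof. by apply: derivable_segment_continuous; case: (Ck_ramp 2 c e) => _ []. Qed.

(** The derivative of the ramp is a probability density carried by the segment
    from [c] to [c + e], so integrating [u] against it gives an average of values close to [u c]. *)
Lemma ramp_average a b u c e eta : a < c -> 0 < e -> c + e < b ->
  segment_continuous a b u ->
  (forall x, c <= x <= c + e -> `|u x - u c| <= eta) ->
  `|\int[mu]_(x in `]a, b[) (u x * (ramp c e)^`() x) - u c| <= eta.
Proof.
move=> ac e0 ceb cu ueta.
have ab : a < b by lra.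
have cr := @ramp_deriv_continuous a b c e.
have I1 : \int[mu]_(x in `]a, b[) (ramp c e)^`() x = 1.
  rewrite (Rintegral_derivative ab (u := ramp c e)); last first.
  - by move=> x _; exact: has_derive_ramp.
  - exact: cr.
  - by apply: derivable_segment_continuous; case: (Ck_ramp 1 c e).
  by rewrite ramp_ge ?ltW// ramp_le ?subr0// ltW.
have cuc : segment_continuous a b (fun x => u x - u c).
  by apply: segment_continuousB => //; exact: segment_continuous_cst.
have cd := segment_continuousM cuc cr.
have -> : \int[mu]_(x in `]a, b[) (u x * (ramp c e)^`() x) - u c =
    \int[mu]_(x in `]a, b[) ((u x - u c) * (ramp c e)^`() x).
  rewrite -[X in _ - X]mulr1 -I1 -RintegralZl//; last exact: integrable_open_segment.
  rewrite -RintegralB//; first by apply: eq_Rintegral => x _; rewrite mulrBl.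
    by apply: integrable_open_segment; exact: segment_continuousM.
  by apply: integrable_open_segment; exact: segment_continuousZ.
apply: le_trans.
  by apply: le_normr_Rintegral => //; exact: integrable_open_segment.
rewrite -[leRHS]mulr1 -I1 -RintegralZl//; last exact: integrable_open_segment.
apply: le_Rintegral => //.
- have := integrable_open_segment cd => /integrable_norm.
  by apply: eq_integrable.
- by apply: integrable_open_segment; exact: segment_continuousZ.
- move=> x _; rewrite normrM (ger0_norm (ramp_deriv_ge0 _ _ e0)).
  have [/ueta ux|xce] := boolP (c <= x <= c + e).
    by rewrite ler_wpM2r// ramp_deriv_ge0.
  by rewrite ramp_deriv_eq0// !mulr0.
Qed.

End Ramp.

(** * Real weak derivatives on an edge *)
Section WeakDerivatives.
Variable R : realType.
Implicit Types (p g u phi : R -> R) (x c d e : R) (n : nat).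
Local Notation mu := (@lebesgue_measure R).
Local Notation L := (2 * pi : R).

Lemma edge_length_gt0 : 0 < L.
Proof. by rewrite mulr_gt0// pi_gt0. Qed.

Definition real_weak_derivative n p g : Prop := forall phi, test_function phi ->
  \int[mu]_(x in @edge R) (p x * derive1n n phi x) =
  (-1) ^+ n * \int[mu]_(x in @edge R) (g x * phi x).

Lemma test_function_outside phi x : test_function phi -> x \notin `]0, L[ -> phi x = 0.
Proof.
move=> [_ _ sub] xe; apply: contrapT => /eqP px; move/negP: xe; apply.
by apply: sub; apply: subset_closure.
Qed.

Lemma test_function_derivable phi x : test_function phi -> derivable phi x 1.
Proof. by move=> [D _ _]; exact: (D 0%N). Qed.

Lemma test_function_continuous phi : test_function phi -> segment_continuous 0 L phi.
Proof.
by move=> tphi; apply: derivable_segment_continuous => x; exact: test_function_derivable.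
Qed.

(** Off the closed support of [phi] the function vanishes near every point,
    and so does its derivative. *)
Lemma test_function_derive1 phi : test_function phi -> test_function phi^`().
Proof.
move=> [D K S].
have sub : [set x | phi^`() x != 0] `<=` closure [set x | phi x != 0].
  move=> x /= px; apply: contrapT => nx; move/eqP: px; apply.
  have : nbhs x (~` closure [set x | phi x != 0]).
    by apply: open_nbhs_nbhs; split => //; apply: closed_openC; exact: closed_closure.
  move=> nx'; apply: has_deriveE.
  apply: (@has_derive_near _ (fun=> 0)); last exact: has_derive_cst.
  near=> y; have [//|py] := eqVneq (phi y) 0.
  have : ~ closure [set x | phi x != 0] y by near: y.
  by case; exact: subset_closure.
have csub : closure [set x | phi^`() x != 0] `<=` closure [set x | phi x != 0].
  have := closure_subset sub; rewrite -[X in _ `<=` X -> _]((closure_id _).1 _)//.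
  exact: closed_closure.
split.
- by move=> n x; rewrite -derive1Sn.
- by apply: subclosed_compact K csub; exact: closed_closure.
- exact: subset_trans csub S.
Unshelve. all: by end_near. Qed.

(** Integration by parts: [u * phi] vanishes at both ends since the support of
    [phi] is inside the open edge. *)
Lemma derivative_weak_derivative u g : segment_continuous 0 L u ->
  segment_continuous 0 L g ->
  (forall x, x \in `]0, L[ -> has_derive u x (g x)) -> real_weak_derivative 1 u g.
Proof.
move=> cu cg ug phi tphi.
have cphi := test_function_continuous tphi.
have cdphi := test_function_continuous (test_function_derive1 tphi).
have D x : x \in `]0, L[ ->
    has_derive (fun x => u x * phi x) x (u x * phi^`() x + g x * phi x).
  move=> xL; have Dphi := derivable_has_derive (test_function_derivable (x := x) tphi).
  by apply: has_derive_eq; [exact: has_deriveM (ug _ xL) Dphi|rewrite (mulrC (phi x))].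
have := Rintegral_derivative edge_length_gt0 _ _ D.
have phi0 : phi 0 = 0 by apply: test_function_outside => //; rewrite in_itv /= ltxx.
have phiL : phi L = 0 by apply: test_function_outside => //; rewrite in_itv /= ltxx andbF.
rewrite phi0 phiL !mulr0 subrr.
rewrite RintegralD//; last 2 first.
- by apply: integrable_open_segment; exact: segment_continuousM.
- by apply: integrable_open_segment; exact: segment_continuousM.
move=> I0; rewrite expr1 mulN1r; apply/eqP; rewrite -addr_eq0; apply/eqP; apply: I0.
- exact: segment_continuousM.
- by apply: segment_continuousD; exact: segment_continuousM.
Qed.

Lemma derivative2_weak_derivative u g h : segment_continuous 0 L u ->
  segment_continuous 0 L g -> segment_continuous 0 L h ->
  (forall x, x \in `]0, L[ -> has_derive u x (g x)) ->
  (forall x, x \in `]0, L[ -> has_derive g x (h x)) -> real_weak_derivative 2 u h.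
Proof.
move=> cu cg ch ug gh phi tphi.
have := derivative_weak_derivative cu cg ug (test_function_derive1 tphi).
have := derivative_weak_derivative cg ch gh tphi.
rewrite !expr1 !mulN1r /= => -> ->.
by rewrite opprK sqrrN expr1n mul1r.
Qed.

Lemma ramp_test_function c d e : 0 < c -> c <= d -> 0 < e -> d + e < L ->
  test_function (fun x => ramp c e x - ramp d e x).
Proof.
move=> c0 cd e0 deL.
have cl : closure [set x | ramp c e x - ramp d e x != 0] `<=` `[c, d + e].
  have /closure_id -> : closed (`[c, d + e]%classic : set R) by exact: interval_closed.
  apply: closure_subset => x /=; rewrite in_itv /=; apply: contraNT.
  rewrite negb_and -!ltNge => /orP[xc|xd].
    by rewrite !ramp_le ?subrr// ltW// (lt_le_trans xc).
  by rewrite !ramp_ge ?subrr// ltW// (le_lt_trans _ xd)// lerD2r.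
split.
- apply/CkP => n; apply: CkD; first exact: Ck_ramp.
  rewrite (_ : (fun x => _) = fun x => -1 * ramp d e x); last first.
    by apply/funext => x; rewrite mulN1r.
  by apply: CkZ; exact: Ck_ramp.
- by apply: subclosed_compact cl; [exact: closed_closure|exact: segment_compact].
- apply: subset_trans cl _ => x; rewrite /edge /= !in_itv /= => /andP[cx xd].
  by rewrite (lt_le_trans c0 cx) (le_lt_trans xd deL).
Qed.

(** The du Bois-Reymond lemma. The difference of two ramps starting at [c] and
    at [d] is a test function, so the averages of [u] just after [c] and just
    after [d] agree; as the ramps get steeper these averages tend to [u c] and
    [u d]. *)
Lemma weak_derivative0_cst u : segment_continuous 0 L u ->
  (forall phi, test_function phi ->
     \int[mu]_(x in @edge R) (u x * phi^`() x) = 0) ->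
  forall c d, c \in `]0, L[ -> d \in `]0, L[ -> u c = u d.
Proof.
move=> cu u0 c d.
wlog cd : c d / c <= d.
  by move=> H cL dL; case: (leP c d) => [|/ltW] ?; [exact: H|apply/esym; exact: H].
move=> cL dL.
have [cont _ _] := (continuous_within_itvP _ edge_length_gt0).1 cu.
have near_u x eta : x \in `]0, L[ -> 0 < eta ->
    exists2 r, 0 < r & forall y, x <= y -> y < x + r -> `|u y - u x| <= eta.
  move=> xL eta0; have /cvgrPdist_le/(_ _ eta0)/nbhs_ballP[r /= r0 rS] := cont _ xL.
  exists r => // y xy yr; rewrite distrC; apply: rS.
  by rewrite /ball /= ler0_norm ?subr_le0// opprB ltrBlDl.
apply/eqP; rewrite -subr_eq0 -normr_le0; apply/ler_addgt0Pr => eps eps0.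
rewrite add0r.
have eta0 : 0 < eps / 2 by rewrite divr_gt0.
have [r1 r10 H1] := near_u c _ cL eta0.
have [r2 r20 H2] := near_u d _ dL eta0.
move: (cL) (dL); rewrite !in_itv /= => /andP[c0 cL'] /andP[d0 dL'].
(* halving keeps the ramps inside the continuity radii and before the end of
   the edge, with strict inequalities *)
pose e := Num.min (Num.min r1 r2) (L - d) / 2.
have e2 : e * 2 = Num.min (Num.min r1 r2) (L - d) by rewrite /e divfK.
have m0 : 0 < e * 2 by rewrite e2 !lt_min r10 r20 subr_gt0.
have : e * 2 <= Num.min (Num.min r1 r2) (L - d) by rewrite e2.
rewrite !le_min => /andP[/andP[er1 er2] eL].
have e0 : 0 < e by lra.
have deL : d + e < L by lra.
have ceL : c + e < L by lra.
have A1 : `|\int[mu]_(x in `]0, L[) (u x * (ramp c e)^`() x) - u c| <= eps / 2.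
  by apply: ramp_average => // x /andP[cx xe]; apply: H1 => //; lra.
have A2 : `|\int[mu]_(x in `]0, L[) (u x * (ramp d e)^`() x) - u d| <= eps / 2.
  by apply: ramp_average => // x /andP[cx xe]; apply: H2 => //; lra.
have := u0 _ (ramp_test_function c0 cd e0 deL); rewrite /edge.
have -> : (fun x => ramp c e x - ramp d e x)^`() =
    fun x => (ramp c e)^`() x - (ramp d e)^`() x.
  apply: has_derive_fun => x; apply: has_deriveB; exact: has_derive_ramp.
under eq_Rintegral do rewrite mulrBr.
rewrite RintegralB//; last 2 first.
- apply: integrable_open_segment; apply: segment_continuousM => //.
  exact: ramp_deriv_continuous.
- apply: integrable_open_segment; apply: segment_continuousM => //.
  exact: ramp_deriv_continuous.
move=> /eqP; rewrite subr_eq0 => /eqP I12; rewrite I12 in A1.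
set I := Rintegral _ _ _ in A1 A2.
rewrite (_ : u c - u d = (I - u d) - (I - u c)); last by ring.
by apply: le_trans (ler_normB _ _) _; rewrite [leRHS]splitr lerD.
Qed.

(** Regularity: if [P] is a primitive of [g], then [p - P] has zero weak
    derivative and is constant by [weak_derivative0_cst]. *)
Lemma weak_derivative_derivative p g : segment_continuous 0 L p ->
  segment_continuous 0 L g -> real_weak_derivative 1 p g ->
  forall x, x \in `]0, L[ -> has_derive p x (g x).
Proof.
move=> cp cg pg x xL.
have [P cP Pg] := primitive_exists edge_length_gt0 cg.
have wP := derivative_weak_derivative cP cg Pg.
have cst : forall c d, c \in `]0, L[ -> d \in `]0, L[ -> p c - P c = p d - P d.
  apply: (weak_derivative0_cst (u := fun x => p x - P x)).
    exact: segment_continuousB.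
  move=> phi tphi; rewrite /edge.
  under eq_Rintegral do rewrite mulrBl.
  have cdphi := test_function_continuous (test_function_derive1 tphi).
  rewrite RintegralB//; last 2 first.
  - by apply: integrable_open_segment; exact: segment_continuousM.
  - by apply: integrable_open_segment; exact: segment_continuousM.
  by have := pg _ tphi; have := wP _ tphi; rewrite !derive1n1 /edge => -> ->; rewrite subrr.
apply: (@has_derive_near _ (fun y => P y + (p x - P x))).
  have := xL; rewrite in_itv /= => /andP[x0 x2].
  near=> y; rewrite (cst x y)//; first by ring.
  rewrite in_itv /=; apply/andP; split; near: y.
    exact: lt_nbhsr.
  exact: lt_nbhsl.
apply: has_derive_eq; first exact: has_deriveD (Pg _ xL) (has_derive_cst _ _).
by rewrite addr0.
Unshelve. all: by end_near. Qed.

End WeakDerivatives.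

(** * Complex-valued functions on an edge *)
Section ComplexValued.
Variable R : realType.
Implicit Types (p g r h : R -> R) (u v : R -> R[i]) (n : nat) (x : R) (l : R[i]).
Local Notation mu := (@lebesgue_measure R).
Local Notation L := (2 * pi : R).
Local Notation Re u := (fun x => complex.Re (u x)).
Local Notation Im u := (fun x => complex.Im (u x)).

Lemma cintegral_mul_real u p :
  cintegral (@edge R) (fun x => u x * (p x)%:C) =
  (\int[mu]_(x in @edge R) (complex.Re (u x) * p x)) +i*
  (\int[mu]_(x in @edge R) (complex.Im (u x) * p x)).
Proof.
rewrite /cintegral; congr (_ +i* _); apply: eq_Rintegral => x _.
  by case: (u x) => a b /=; rewrite mulr0 subr0.
by case: (u x) => a b /=; rewrite mulr0 add0r.
Qed.

Lemma sign_mul_complex n (a b : R) :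
  (-1) ^+ n * (a +i* b) = ((-1) ^+ n * a) +i* ((-1) ^+ n * b) :> R[i].
Proof.
elim: n a b => [|n IHn] a b; first by rewrite !expr0 !mul1r.
by rewrite !exprS -!mulrA IHn !mulN1r.
Qed.

(** Test functions being real, a complex weak derivative is a pair of real
    ones. *)
Lemma weak_derivativeP n u v : weak_derivative n u v <->
  real_weak_derivative n (Re u) (Re v) /\ real_weak_derivative n (Im u) (Im v).
Proof.
split=> [w|[wr wi] phi tphi].
  split=> phi tphi; have := w _ tphi;
    by rewrite !cintegral_mul_real sign_mul_complex => -[].
by rewrite !cintegral_mul_real sign_mul_complex wr// wi.
Qed.

Lemma measurable_edge : measurable (@edge R).
Proof. exact: measurable_itv. Qed.

Lemma measurable_segment_continuous p :
  segment_continuous 0 L p -> measurable_fun (@edge R) p.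
Proof.
move=> cp; apply/measurable_EFinP; apply: (measurable_int mu).
exact: integrable_open_segment.
Qed.

Lemma Rintegral_ae_eq p g h : measurable_fun (@edge R) p ->
  measurable_fun (@edge R) g -> measurable_fun (@edge R) h ->
  ae_eq mu (@edge R) p g ->
  \int[mu]_(x in @edge R) (p x * h x) = \int[mu]_(x in @edge R) (g x * h x).
Proof.
move=> mp mg mh pg; rewrite /Rintegral; congr fine.
apply: ae_eq_integral.
- exact: measurable_edge.
- by apply/measurable_EFinP; exact: measurable_funM.
- by apply/measurable_EFinP; exact: measurable_funM.
- by apply: filterS pg => x pg xL; rewrite pg.
Qed.

Lemma test_function_derive1n_continuous n (phi : R -> R) :
  test_function phi -> segment_continuous 0 L (derive1n n phi).
Proof. by move=> [D _ _]; apply: derivable_segment_continuous; exact: D. Qed.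

Lemma real_weak_derivative_ae_eq n p p' g g' :
  measurable_fun (@edge R) p -> measurable_fun (@edge R) g ->
  measurable_fun (@edge R) p' -> measurable_fun (@edge R) g' ->
  ae_eq mu (@edge R) p p' -> ae_eq mu (@edge R) g g' ->
  real_weak_derivative n p g -> real_weak_derivative n p' g'.
Proof.
move=> mp mg mp' mg' pp gg w phi tphi.
have mphi m := measurable_segment_continuous (test_function_derive1n_continuous (n := m) tphi).
rewrite -(Rintegral_ae_eq mp mp' (mphi n) pp) -(Rintegral_ae_eq mg mg' (mphi 0%N) gg).
exact: w.
Qed.

(** Test the first relation against the derivative of a test function. This is
    how the continuous first derivative of an eigenfunction inherits a weak
    derivative from the eigenvalue equation. *)
Lemma real_weak_derivative_second p r h : real_weak_derivative 1 p r ->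
  real_weak_derivative 2 p h -> real_weak_derivative 1 r h.
Proof.
move=> pr ph phi tphi.
have := ph _ tphi; have := pr _ (test_function_derive1 tphi).
rewrite !derive1n1 /= => ->; rewrite expr1 sqrrN expr1n mul1r => <-.
by rewrite !mulN1r opprK.
Qed.

Lemma in_L2_real p : segment_continuous 0 L p -> in_L2 (fun x => (p x)%:C).
Proof.
move=> cp; split => /=.
- exact: measurable_segment_continuous.
- exact: measurable_cst.
- have := integrable_open_segment (segment_continuousM cp cp).
  move=> /integrableP[_]; apply: le_lt_trans.
  apply: ge0_le_integral => //=.
  + exact: measurable_edge.
  + by move=> x _; rewrite lee_fin addr_ge0// sqr_ge0.
  + apply/measurable_EFinP; apply: measurable_funD; apply: measurable_funX.
      exact: measurable_segment_continuous.
    exact: measurable_cst.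
  + apply/measurable_EFinP; apply: measurableT_comp => //.
    by apply: measurable_funM; exact: measurable_segment_continuous.
  + by move=> x _; rewrite lee_fin expr0n addr0 -expr2 ler_norm.
Qed.

Lemma weak_derivative_real n p g : real_weak_derivative n p g ->
  weak_derivative n (fun x => (p x)%:C) (fun x => (g x)%:C).
Proof.
move=> w; apply/weak_derivativeP; split=> //= phi tphi.
suff H h : \int[mu]_(x in @edge R) (0 * h x) = 0 by rewrite !H mulr0.
by under eq_Rintegral do rewrite mul0r; rewrite Rintegral_cst ?mul0r//; exact: measurable_edge.
Qed.

Lemma eq_L2_zero u : continuous_on_cedge u -> eq_L2 u (fun=> 0) ->
  forall x, x \in `[0, L] -> u x = 0.
Proof.
move=> [cr ci] u0 x xL; apply/eqP; rewrite eq_complex /=; apply/andP; split; apply/eqP.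
  apply: (segment_continuous_eq0 (edge_length_gt0 R) cr _ xL).
  by apply: filterS u0 => y + yL => -> //.
apply: (segment_continuous_eq0 (edge_length_gt0 R) ci _ xL).
by apply: filterS u0 => y + yL => -> //.
Qed.

End ComplexValued.

(** * Eigenfunctions are classical solutions *)
Section GraphSolutions.
Variable R : realType.
Local Notation mu := (@lebesgue_measure R).
Local Notation L := (2 * pi : R).

(** The real form of the eigenvalue equation for A + iB on the graph: on edge
    [j] the function is [p j + i q j], its derivative is [r j + i s j], and both
    are classical solutions of a first-order system, continuous up to the
    vertices, where they satisfy the Kirchhoff conditions. *)
Record graph_solution (A B : R) (p q r s : 'I_3 -> R -> R) : Prop := GraphSolution {
  sol_p_cont : forall j, segment_continuous 0 L (p j);
  sol_q_cont : forall j, segment_continuous 0 L (q j);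
  sol_r_cont : forall j, segment_continuous 0 L (r j);
  sol_s_cont : forall j, segment_continuous 0 L (s j);
  sol_dp : forall j x, x \in `]0, L[ -> has_derive (p j) x (r j x);
  sol_dq : forall j x, x \in `]0, L[ -> has_derive (q j) x (s j x);
  sol_dr : forall j x, x \in `]0, L[ -> has_derive (r j) x (- (A * p j x - B * q j x));
  sol_ds : forall j x, x \in `]0, L[ -> has_derive (s j) x (- (A * q j x + B * p j x));
  sol_p0 : forall i j, p i 0 = p j 0;
  sol_pL : forall i j, p i L = p j L;
  sol_q0 : forall i j, q i 0 = q j 0;
  sol_qL : forall i j, q i L = q j L;
  sol_r0 : \sum_(j < 3) r j 0 = 0;
  sol_rL : \sum_(j < 3) r j L = 0;
  sol_s0 : \sum_(j < 3) s j 0 = 0;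
  sol_sL : \sum_(j < 3) s j L = 0 }.

Lemma Re_sum (I : finType) (z : I -> R[i]) :
  complex.Re (\sum_i z i) = \sum_i complex.Re (z i).
Proof. by apply: (big_ind2 (fun w a => complex.Re w = a)) => // -[a b] c [d e] f /= -> ->. Qed.

Lemma Im_sum (I : finType) (z : I -> R[i]) :
  complex.Im (\sum_i z i) = \sum_i complex.Im (z i).
Proof. by apply: (big_ind2 (fun w a => complex.Im w = a)) => // -[a b] c [d e] f /= -> ->. Qed.

(** Elliptic regularity in dimension one: the continuous representatives of the
    function and of its weak derivative, given by the domain, have continuous
    weak derivatives, hence classical ones by [weak_derivative_derivative]. *)
Lemma eigenspace_graph_solution A B f : eigenspace_H0 (A +i* B) f ->
  exists p q r s, graph_solution A B p q r s /\
    forall j, eq_L2 (f j) (fun x => p j x +i* q j x).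
Proof.
move=> [[fH2 [F [G [cF cG FV G0 GL]]]] _ w2].
pose p j x := complex.Re (F j x); pose q j x := complex.Im (F j x).
pose r j x := complex.Re (G j x); pose s j x := complex.Im (G j x).
exists p, q, r, s.
have cp j : segment_continuous 0 L (p j) by case: (cF j) => -[].
have cq j : segment_continuous 0 L (q j) by case: (cF j) => -[].
have cr j : segment_continuous 0 L (r j) by case: (cG j) => -[].
have cs j : segment_continuous 0 L (s j) by case: (cG j) => -[].
have eqF j : eq_L2 (f j) (F j) by case: (cF j).
have fp j : ae_eq mu (@edge R) (fun x => complex.Re (f j x)) (p j).
  by apply: filterS (eqF j) => x + xL => ->.
have fq j : ae_eq mu (@edge R) (fun x => complex.Im (f j x)) (q j).
  by apply: filterS (eqF j) => x + xL => ->.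
have mfr j : measurable_fun (@edge R) (fun x => complex.Re (f j x)).
  by case: (fH2 j) => -[].
have mfi j : measurable_fun (@edge R) (fun x => complex.Im (f j x)).
  by case: (fH2 j) => -[].
have mc := @measurable_segment_continuous R.
have /= w1 j := (weak_derivativeP 1 (f j) (G j)).1 (cG j).2.
have pr j : real_weak_derivative 1 (p j) (r j).
  apply: real_weak_derivative_ae_eq (w1 j).1;
    [exact: mfr|exact: (mc _ (cr j))|exact: (mc _ (cp j))|exact: (mc _ (cr j))|
     exact: fp|].
  exact: ae_eq_refl.
have qs j : real_weak_derivative 1 (q j) (s j).
  apply: real_weak_derivative_ae_eq (w1 j).2;
    [exact: mfi|exact: (mc _ (cs j))|exact: (mc _ (cq j))|exact: (mc _ (cs j))|
     exact: fq|].
  exact: ae_eq_refl.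
have {}w2 j := (weak_derivativeP 2 (f j) _).1 (w2 j).
pose r' j x := - (A * p j x - B * q j x).
pose s' j x := - (A * q j x + B * p j x).
have cr' j : segment_continuous 0 L (r' j).
  by apply/segment_continuousN/segment_continuousB; exact: segment_continuousZ.
have cs' j : segment_continuous 0 L (s' j).
  by apply/segment_continuousN/segment_continuousD; exact: segment_continuousZ.
have mlin a b (g h : R -> R) : measurable_fun (@edge R) g -> measurable_fun (@edge R) h ->
    measurable_fun (@edge R) (fun x => - (a * g x + b * h x)).
  move=> mg mh; apply: measurable_funN; apply: measurable_funD;
    apply: measurable_funM => //; exact: measurable_cst.
have rr' j : real_weak_derivative 1 (r j) (r' j).
  apply: real_weak_derivative_second (pr j) _.
  apply: real_weak_derivative_ae_eq (w2 j).1;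
    [exact: mfr| |exact: (mc _ (cp j))|exact: (mc _ (cr' j))|
     exact: fp|].
    rewrite (_ : (fun x => _) = fun x => - (A * complex.Re (f j x) + - B * complex.Im (f j x))).
      exact: mlin.
    by apply/funext => x; case: (f j x) => a b /=; rewrite mulNr.
  by apply: filterS (eqF j) => x + xL => ->//; rewrite /r' /p /q; case: (F j x) => a b.
have ss' j : real_weak_derivative 1 (s j) (s' j).
  apply: real_weak_derivative_second (qs j) _.
  apply: real_weak_derivative_ae_eq (w2 j).2;
    [exact: mfi| |exact: (mc _ (cq j))|exact: (mc _ (cs' j))|
     exact: fq|].
    rewrite (_ : (fun x => _) = fun x => - (A * complex.Im (f j x) + B * complex.Re (f j x))).
      exact: mlin.
    by apply/funext => x; case: (f j x) => a b /=.
  by apply: filterS (eqF j) => x + xL => ->//; rewrite /s' /p /q; case: (F j x) => a b.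
split; last first.
  by move=> j; apply: filterS (eqF j) => x + xL => ->//; rewrite /p /q; case: (F j x).
split=> //.
- by move=> j; exact: weak_derivative_derivative.
- by move=> j; exact: weak_derivative_derivative.
- by move=> j; exact: (weak_derivative_derivative (cr j) (cr' j)).
- by move=> j; exact: (weak_derivative_derivative (cs j) (cs' j)).
- by move=> i j; rewrite /p (FV i j).1.
- by move=> i j; rewrite /p (FV i j).2.
- by move=> i j; rewrite /q (FV i j).1.
- by move=> i j; rewrite /q (FV i j).2.
- by rewrite -Re_sum G0.
- by rewrite -Re_sum GL.
- by rewrite -Im_sum G0.
- by rewrite -Im_sum GL.
Qed.

End GraphSolutions.

(** * Zeros of the sine *)
Section SineZeros.
Variable R : realType.
Implicit Types (x : R) (k : nat).

Lemma sin_natmul_pi k : sin (k%:R * pi) = 0 :> R.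
Proof.
by have := alternatingn (@sinDpi R) k 0; rewrite add0r sin0 mulr0 mulr_natl.
Qed.

(** Subtract from [x] the largest multiple of pi below it: the sine of the
    remainder y, with 0 <= y < pi, is zero up to sign, while it is positive for
    y > 0. *)
Lemma sin_eq0_gt0 x : 0 < x -> sin x = 0 -> exists2 k, (1 <= k)%N & x = k%:R * pi.
Proof.
move=> x0 sx; have pi0 := pi_gt0 R.
have /andP[kx xk] := truncn_itv (ltW (divr_gt0 x0 pi0)).
set k := Num.truncn _ in kx xk; pose y := x - k%:R * pi.
have xE : x = y + pi *+ k by rewrite /y mulr_natl subrK.
have y0 : 0 <= y by rewrite subr_ge0 -ler_pdivlMr.
have ypi : y < pi.
  by move: xk; rewrite ltr_pdivrMr// -natr1 mulrDl mul1r -ltrBlDl.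
have yE : y = 0.
  move: sx; rewrite xE (alternatingn (@sinDpi R)) => /eqP.
  rewrite mulf_eq0 signr_eq0 /= => /eqP sy.
  apply/eqP; rewrite eq_le y0 andbT leNgt; apply/negP => y1.
  by have := @sin_gt0_pi R y; rewrite y1 ypi sy ltxx => /(_ isT).
exists k; last by move: xE; rewrite yE add0r mulr_natl.
rewrite lt0n; apply/eqP => k0; move: x0.
by rewrite xE yE k0 mulr0n addr0 ltxx.
Qed.

End SineZeros.

(** * The differential system on the graph *)
Section GraphODE.
Variable R : realType.
Local Notation L := (2 * pi : R).
Implicit Types (A B m : R) (p q r s : 'I_3 -> R -> R).

Lemma has_derive_sum n (h dh : 'I_n -> R -> R) x :
  (forall i, has_derive (h i) x (dh i x)) ->
  has_derive (fun y => \sum_(i < n) h i y) x (\sum_(i < n) dh i x).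
Proof.
elim: n h dh => [|n IHn] h dh hD.
  rewrite big_ord0 (_ : (fun y => _) = fun=> 0); first exact: has_derive_cst.
  by apply/funext => y; rewrite big_ord0.
rewrite big_ord_recl (_ : (fun y => _) =
  fun y => h ord0 y + \sum_(i < n) h (lift ord0 i) y).
  by apply: has_deriveD; [exact: hD|
    exact: (IHn (fun i => h (lift ord0 i)) (fun i => dh (lift ord0 i)))].
by apply/funext => y; rewrite big_ord_recl.
Qed.

Lemma segment_continuous_sum n (h : 'I_n -> R -> R) a b :
  (forall i, segment_continuous a b (h i)) ->
  segment_continuous a b (fun y => \sum_(i < n) h i y).
Proof.
elim: n h => [|n IHn] h hC.
  rewrite (_ : (fun y => _) = fun=> 0); first exact: segment_continuous_cst.
  by apply/funext => y; rewrite big_ord0.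
rewrite (_ : (fun y => _) = fun y => h ord0 y + \sum_(i < n) h (lift ord0 i) y).
  by apply: segment_continuousD; [exact: hC|apply: IHn => i; exact: hC].
by apply/funext => y; rewrite big_ord_recl.
Qed.

(** The Kirchhoff condition kills every boundary term: a function continuous at
    a vertex factors out of the sum of the derivatives. *)
Lemma vertex_sum_eq0 (u v : 'I_3 -> R) :
  (forall i j, u i = u j) -> \sum_j v j = 0 -> \sum_j u j * v j = 0.
Proof.
move=> uE v0; under eq_bigr do rewrite (uE _ ord0).
by rewrite -mulr_sumr v0 mulr0.
Qed.

Lemma sum_sqr_eq0 (u v : 'I_3 -> R) :
  \sum_j (u j ^+ 2 + v j ^+ 2) = 0 -> forall j, u j = 0 /\ v j = 0.
Proof.
move=> uv0 j.
have /psumr_eq0P/(_ uv0 j isT)/eqP : forall i : 'I_3, true -> 0 <= u i ^+ 2 + v i ^+ 2.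
  by move=> i _; rewrite addr_ge0 ?sqr_ge0.
by rewrite paddr_eq0 ?sqr_ge0// !sqrf_eq0 => /andP[/eqP -> /eqP ->].
Qed.

(** Eigenvalues are real. The Wronskian sum of q p' - p q' vanishes at both
    vertices and has derivative B times the sum of p^2 + q^2; the factor [B] in
    [W] makes the derivative B^2 times this sum, of known sign. *)
Lemma graph_solution_imaginary A B p q r s : graph_solution A B p q r s -> B != 0 ->
  forall j x, x \in `]0, L[ -> p j x = 0 /\ q j x = 0.
Proof.
move=> S B0 j x xL.
pose W x := B * \sum_j (q j x * r j x - p j x * s j x).
pose W' x := B * \sum_j (B * (p j x ^+ 2 + q j x ^+ 2)).
have cW : segment_continuous 0 L W.
  apply/segment_continuousZ/segment_continuous_sum => i.
  by apply: segment_continuousB; apply: segment_continuousM; case: S.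
have DW y : y \in `]0, L[ -> has_derive W y (W' y).
  move=> yL; apply: has_deriveZ.
  apply: (has_derive_sum (h := fun i x => q i x * r i x - p i x * s i x)
    (dh := fun i x => B * (p i x ^+ 2 + q i x ^+ 2))) => i.
  apply: has_derive_eq.
    exact: has_deriveB (has_deriveM (sol_dq S i yL) (sol_dr S i yL))
      (has_deriveM (sol_dp S i yL) (sol_ds S i yL)).
  by ring.
have W'E y : W' y = B ^+ 2 * \sum_j (p j y ^+ 2 + q j y ^+ 2).
  by rewrite /W' -mulr_sumr mulrA.
have W'0 y : y \in `]0, L[ -> 0 <= W' y.
  by move=> _; rewrite W'E mulr_ge0 ?sqr_ge0// sumr_ge0// => i _; rewrite addr_ge0 ?sqr_ge0.
have W0 : W 0 = W L.
  rewrite /W !sumrB !vertex_sum_eq0 ?subrr//; by case: S.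
have := ge0_derivative_eq0 cW DW W'0 W0 xL.
rewrite W'E => /eqP; rewrite mulf_eq0 sqrf_eq0 (negbTE B0) /= => /eqP.
by move/sum_sqr_eq0; apply.
Qed.

(** Eigenvalues are nonnegative. The sum of p p' + q q' vanishes at both
    vertices and its derivative, the sum of p'^2 + q'^2 - A (p^2 + q^2), is
    nonnegative when A <= 0; so both parts vanish. For A = 0 this still gives
    p' = q' = 0. *)
Lemma graph_solution_energy A B p q r s : graph_solution A B p q r s -> A <= 0 ->
  forall j x, x \in `]0, L[ ->
    [/\ r j x = 0, s j x = 0 & A != 0 -> p j x = 0 /\ q j x = 0].
Proof.
move=> S A0 j x xL.
pose E x := \sum_j (p j x * r j x + q j x * s j x).
pose E' x := \sum_j ((r j x ^+ 2 + s j x ^+ 2) + - A * (p j x ^+ 2 + q j x ^+ 2)).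
have cE : segment_continuous 0 L E.
  apply: segment_continuous_sum => i.
  by apply: segment_continuousD; apply: segment_continuousM; case: S.
have DE y : y \in `]0, L[ -> has_derive E y (E' y).
  move=> yL.
  apply: (has_derive_sum (h := fun i x => p i x * r i x + q i x * s i x)
    (dh := fun i x => (r i x ^+ 2 + s i x ^+ 2) + - A * (p i x ^+ 2 + q i x ^+ 2))) => i.
  apply: has_derive_eq.
    exact: has_deriveD (has_deriveM (sol_dp S i yL) (sol_dr S i yL))
      (has_deriveM (sol_dq S i yL) (sol_ds S i yL)).
  by ring.
have rs0 y : 0 <= \sum_j (r j y ^+ 2 + s j y ^+ 2).
  by rewrite sumr_ge0// => i _; rewrite addr_ge0 ?sqr_ge0.
have pq0 y : 0 <= - A * \sum_j (p j y ^+ 2 + q j y ^+ 2).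
  by rewrite mulr_ge0 ?oppr_ge0// sumr_ge0// => i _; rewrite addr_ge0 ?sqr_ge0.
have E'E y : E' y = \sum_j (r j y ^+ 2 + s j y ^+ 2) +
    - A * \sum_j (p j y ^+ 2 + q j y ^+ 2).
  by rewrite /E' big_split /= -mulr_sumr.
have E'0 y : y \in `]0, L[ -> 0 <= E' y.
  by move=> _; rewrite E'E addr_ge0.
have E0 : E 0 = E L.
  by rewrite /E !big_split /= !vertex_sum_eq0 ?addr0//; case: S.
have := ge0_derivative_eq0 cE DE E'0 E0 xL.
rewrite E'E => /eqP; rewrite paddr_eq0// mulf_eq0 oppr_eq0.
move=> /andP[/eqP/sum_sqr_eq0/(_ j)[-> ->] Apq]; split=> // An0; move: Apq.
by rewrite (negbTE An0) => /eqP/sum_sqr_eq0; apply.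
Qed.

Lemma has_derive_cos m x : has_derive (fun y => cos (m * y)) x (- (m * sin (m * x))).
Proof.
apply: has_derive_eq.
  exact: has_derive_comp (is_derive_cos _) (has_deriveZ m (has_derive_id x)).
by rewrite mulr1 mulNr mulrC.
Qed.

Lemma has_derive_sin m x : has_derive (fun y => sin (m * y)) x (m * cos (m * x)).
Proof.
apply: has_derive_eq.
  exact: has_derive_comp (is_derive_sin _) (has_deriveZ m (has_derive_id x)).
by rewrite mulr1 mulrC.
Qed.

Lemma has_derive_continuous a b (f df : R -> R) :
  (forall x, has_derive f x (df x)) -> segment_continuous a b f.
Proof.
by move=> fD; apply: derivable_segment_continuous => x; exact: has_derive_derivable (fD x).
Qed.

(** Rotating (m u, v) by the angle m x gives two constants of motion; undoing
    the rotation gives the solution. *)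
Lemma oscillator m u v : m != 0 -> segment_continuous 0 L u -> segment_continuous 0 L v ->
  (forall x, x \in `]0, L[ -> has_derive u x (v x)) ->
  (forall x, x \in `]0, L[ -> has_derive v x (- (m ^+ 2 * u x))) ->
  forall x, x \in `[0, L] ->
    u x = u 0 * cos (m * x) + v 0 / m * sin (m * x) /\
    v x = m * (v 0 / m * cos (m * x) - u 0 * sin (m * x)).
Proof.
move=> m0 cu cv uv vu x xL.
pose C y := cos (m * y); pose S y := sin (m * y).
have cC : segment_continuous 0 L C := has_derive_continuous (has_derive_cos m).
have cS : segment_continuous 0 L S := has_derive_continuous (has_derive_sin m).
have C0 : C 0 = 1 by rewrite /C mulr0 cos0.
have S0 : S 0 = 0 by rewrite /S mulr0 sin0.
have H1 : m * u x * C x - v x * S x = m * u 0.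
  rewrite -[RHS](_ : m * u 0 * C 0 - v 0 * S 0 = _); last by rewrite C0 S0; ring.
  apply: (zero_derivative_cst (u := fun x => m * u x * C x - v x * S x) _ _ xL).
    by apply: segment_continuousB; apply: segment_continuousM => //; exact: segment_continuousZ.
  move=> y yL; apply: has_derive_eq.
    exact: has_deriveB (has_deriveM (has_deriveZ m (uv _ yL)) (has_derive_cos m y))
      (has_deriveM (vu _ yL) (has_derive_sin m y)).
  by rewrite /C /S; ring.
have H2 : m * u x * S x + v x * C x = v 0.
  rewrite -[RHS](_ : m * u 0 * S 0 + v 0 * C 0 = _); last by rewrite C0 S0; ring.
  apply: (zero_derivative_cst (u := fun x => m * u x * S x + v x * C x) _ _ xL).
    by apply: segment_continuousD; apply: segment_continuousM => //; exact: segment_continuousZ.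
  move=> y yL; apply: has_derive_eq.
    exact: has_deriveD (has_deriveM (has_deriveZ m (uv _ yL)) (has_derive_sin m y))
      (has_deriveM (vu _ yL) (has_derive_cos m y)).
  by rewrite /C /S; ring.
have CS : C x ^+ 2 + S x ^+ 2 = 1 by exact: cos2Dsin2.
rewrite -/(C x) -/(S x); split.
  apply: (mulfI m0); rewrite -[LHS]mulr1 -CS.
  rewrite (_ : m * (u 0 * C x + v 0 / m * S x) = (m * u 0) * C x + v 0 * S x).
    by rewrite -H1 -H2; ring.
  by field.
rewrite (_ : m * (v 0 / m * C x - u 0 * S x) = v 0 * C x - (m * u 0) * S x).
  by rewrite -H1 -H2 -[LHS]mulr1 -CS; ring.
by field.
Qed.

End GraphODE.

(** * Trigonometric functions on the graph *)
Section Eigenfunctions.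
Variable R : realType.
Local Notation L := (2 * pi : R).
Implicit Types (m al : R) (be : 'I_3 -> R) (u v : 'I_3 -> R -> R).

Definition trig_wave m al be (j : 'I_3) (x : R) : R :=
  al * cos (m * x) + be j * sin (m * x).

Definition trig_function m al be : graph_function R :=
  fun j x => (trig_wave m al be j x)%:C.

Definition trig_slope m al be (j : 'I_3) (x : R) : R :=
  m * (be j * cos (m * x) - al * sin (m * x)).

Lemma has_derive_trig_wave m al be j x :
  has_derive (trig_wave m al be j) x (trig_slope m al be j x).
Proof.
apply: has_derive_eq.
  exact: has_deriveD (has_deriveZ al (has_derive_cos m x))
    (has_deriveZ (be j) (has_derive_sin m x)).
by rewrite /trig_slope; ring.
Qed.

Lemma has_derive_trig_slope m al be j x :
  has_derive (trig_slope m al be j) x (- (m ^+ 2 * trig_wave m al be j x)).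
Proof.
apply: has_derive_eq.
  apply: has_deriveZ; exact: has_deriveB (has_deriveZ (be j) (has_derive_cos m x))
    (has_deriveZ al (has_derive_sin m x)).
by rewrite /trig_wave; ring.
Qed.

Lemma trig_wave_continuous m al be j a b : segment_continuous a b (trig_wave m al be j).
Proof. exact: has_derive_continuous (has_derive_trig_wave m al be j). Qed.

Lemma trig_slope_continuous m al be j a b : segment_continuous a b (trig_slope m al be j).
Proof. exact: has_derive_continuous (has_derive_trig_slope m al be j). Qed.

Lemma continuous_on_cedge_real (p : R -> R) : segment_continuous 0 L p ->
  continuous_on_cedge (fun x => (p x)%:C).
Proof. by move=> cp; split=> //=; exact: segment_continuous_cst. Qed.

(** When sin (2 pi m) = 0 the sine terms vanish at both vertices, so the values
    there do not depend on the edge, and the derivatives there are multiples of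
    the [be j] plus terms in sin (2 pi m). *)
Lemma trig_function_eigenspace m al be : sin (m * L) = 0 -> \sum_j be j = 0 ->
  eigenspace_H0 ((m ^+ 2)%:C) (trig_function m al be).
Proof.
move=> sL be0.
have cu j := @trig_wave_continuous m al be j 0 L.
have cv j := @trig_slope_continuous m al be j 0 L.
have cw j : segment_continuous 0 L (fun x => - (m ^+ 2 * trig_wave m al be j x)).
  by apply: segment_continuousN; exact: segment_continuousZ.
have w1 j : weak_derivative 1 (trig_function m al be j) (fun x => (trig_slope m al be j x)%:C).
  apply: weak_derivative_real; apply: derivative_weak_derivative => // x _.
  exact: has_derive_trig_wave.
have w2 j : weak_derivative 2 (trig_function m al be j)
    (fun x => (- (m ^+ 2 * trig_wave m al be j x))%:C).
  apply: weak_derivative_real.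
  apply: (derivative2_weak_derivative (g := trig_slope m al be j)) => // x _.
    exact: has_derive_trig_wave.
  exact: has_derive_trig_slope.
split.
- split.
    move=> j; split; first exact: in_L2_real.
    exists (fun x => (trig_slope m al be j x)%:C),
      (fun x => (- (m ^+ 2 * trig_wave m al be j x))%:C).
    by split=> //; exact: in_L2_real.
  exists (trig_function m al be), (fun j x => (trig_slope m al be j x)%:C); split.
  + by move=> j; split; [exact: continuous_on_cedge_real|exact: ae_eq_refl].
  + by move=> j; split; [exact: continuous_on_cedge_real|].
  + by move=> i j; rewrite /trig_function /trig_wave sL !mulr0 sin0 !mulr0.
  + rewrite -rmorph_sum /=; congr (_%:C).
    under eq_bigr do rewrite /trig_slope mulr0 sin0 cos0 mulr0 subr0 mulr1.
    by rewrite -mulr_sumr be0 mulr0.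
  + rewrite -rmorph_sum /=; congr (_%:C).
    under eq_bigr do rewrite /trig_slope sL mulr0 subr0.
    by rewrite -mulr_sumr -mulr_suml be0 mul0r mulr0.
- move=> j; have -> : (fun x => (m ^+ 2)%:C * trig_function m al be j x) =
      fun x => (m ^+ 2 * trig_wave m al be j x)%:C.
    by apply/funext => x; rewrite [RHS]rmorphM.
  by apply: in_L2_real; exact: segment_continuousZ.
- move=> j; have -> : (fun x => - ((m ^+ 2)%:C * trig_function m al be j x)) =
      fun x => (- (m ^+ 2 * trig_wave m al be j x))%:C.
    by apply/funext => x; rewrite [RHS]rmorphN; congr (- _); rewrite [RHS]rmorphM.
  exact: w2.
Qed.

(** By continuity at the first vertex all edges share the cosine coefficient
    [al]. At the second vertex the Kirchhoff condition reads al sin (2 pi m) = 0,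
    and continuity makes the [be j * sin (2 pi m)] equal; if the sine is not 0,
    then [al] is 0 and the [be j] are equal with zero sum, hence 0. *)
Lemma kirchhoff_oscillators m u v : m != 0 ->
  (forall j, segment_continuous 0 L (u j)) -> (forall j, segment_continuous 0 L (v j)) ->
  (forall j x, x \in `]0, L[ -> has_derive (u j) x (v j x)) ->
  (forall j x, x \in `]0, L[ -> has_derive (v j) x (- (m ^+ 2 * u j x))) ->
  (forall i j, u i 0 = u j 0) -> (forall i j, u i L = u j L) ->
  \sum_j v j 0 = 0 -> \sum_j v j L = 0 ->
  exists al be, [/\ \sum_j be j = 0,
    forall j x, x \in `[0, L] -> u j x = trig_wave m al be j x &
    sin (m * L) != 0 -> al = 0 /\ forall j, be j = 0].
Proof.
move=> m0 cu cv uv vu u0 uL v0 vL.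
have osc j := oscillator m0 (cu j) (cv j) (uv j) (vu j).
pose al := u ord0 0; pose be j := v j 0 / m.
have be0 : \sum_j be j = 0 by rewrite -mulr_suml v0 mul0r.
have L0 : L \in `[0, L] by rewrite in_itv /= lexx ltW// edge_length_gt0.
have uE j x : x \in `[0, L] -> u j x = trig_wave m al be j x.
  by move=> xL; rewrite (osc j x xL).1 (u0 j ord0).
exists al, be; split=> // sL.
have al0 : al = 0.
  move: vL; under eq_bigr do rewrite (osc _ _ L0).2 (u0 _ ord0) -/al.
  rewrite -mulr_sumr sumrB -mulr_suml -/be be0 mul0r sub0r sumr_const card_ord.
  move=> /eqP; rewrite mulf_eq0 (negbTE m0) oppr_eq0 mulrn_eq0 mulf_eq0 (negbTE sL) orbF /=.
  by move/eqP.
split=> // j.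
have beE i : be i = be j.
  apply: (mulIf sL); have := uL i j; rewrite !uE// /trig_wave al0 !mul0r !add0r.
  exact.
move: be0; under eq_bigr do rewrite beE.
by rewrite sumr_const card_ord => /eqP; rewrite mulrn_eq0 /= => /eqP.
Qed.

Lemma phi0_trig : phi0 R = trig_function 0 1 (fun=> 0).
Proof.
apply/funext => j; apply/funext => x.
by rewrite /phi0 /trig_function /trig_wave !mul0r cos0 mulr1 addr0.
Qed.

(** The sine coefficients on the three edges of the two antisymmetric families;
    they form a basis of the vectors of zero sum. *)
Definition sine_sign2 (j : 'I_3) : R := tnth [tuple -1; 1; 0] j.
Definition sine_sign3 (j : 'I_3) : R := tnth [tuple -1; 0; 1] j.

Lemma phi1_trig k : phi1 R k = trig_function (k%:R / 2) 1 (fun=> 0).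
Proof.
apply/funext => j; apply/funext => x; rewrite /trig_function /trig_wave mul1r mul0r addr0.
by case: j => [[|[|[|//]]] ij]; rewrite /phi1 /triple (tnth_nth (fun=> 0)).
Qed.

Lemma phi2_trig k : phi2 R k = trig_function (k%:R / 2) 0 sine_sign2.
Proof.
apply/funext => j; apply/funext => x; rewrite /trig_function /trig_wave mul0r add0r.
case: j => [[|[|[|//]]] ij];
  rewrite /phi2 /triple /sine_sign2 (tnth_nth (fun=> 0)) (tnth_nth 0) /= ?mulN1r ?mul1r ?mul0r//.
by rewrite rmorphN.
Qed.

Lemma phi3_trig k : phi3 R k = trig_function (k%:R / 2) 0 sine_sign3.
Proof.
apply/funext => j; apply/funext => x; rewrite /trig_function /trig_wave mul0r add0r.
case: j => [[|[|[|//]]] ij];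
  rewrite /phi3 /triple /sine_sign3 (tnth_nth (fun=> 0)) (tnth_nth 0) /= ?mulN1r ?mul1r ?mul0r//.
by rewrite rmorphN.
Qed.

End Eigenfunctions.

(** * Spectrum and eigenbases *)
Section Spectrum.
Variable R : realType.
Local Notation L := (2 * pi : R).
Implicit Types (l : R[i]) (f : graph_function R) (k : nat).

Lemma in_edge_cc x : @edge R x -> x \in `[0, L].
Proof. by move=> xL; exact: subset_itv_oo_cc. Qed.

Lemma eq_L2G_pointwise f h : (forall j, eq_L2 (f j) (h j)) ->
  (forall j x, x \in `]0, L[ -> h j x = 0) -> eq_L2G f (fun _ _ => 0).
Proof.
by move=> fh h0 j; apply: filterS (fh j) => x fhx xL; rewrite fhx// h0.
Qed.

(** The Wronskian gives a real eigenvalue, the energy a nonnegative one; if it is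
    m^2 > 0, a nonzero solution forces sin (2 pi m) = 0, hence 2 pi m = k pi. *)
Lemma eigenvalue_form l : eigenvalue_H0 l ->
  l = 0 \/ exists k, (1 <= k)%N /\ l = lambda R k.
Proof.
case: l => A B [f [fl fn0]].
have [p [q [r [s [S fpq]]]]] := eigenspace_graph_solution fl.
have pq0 : ~ forall j x, x \in `]0, L[ -> p j x = 0 /\ q j x = 0.
  move=> H; apply: fn0; apply: (eq_L2G_pointwise fpq) => j x xL.
  by have [-> ->] := H j x xL.
have B0 : B = 0.
  by apply/eqP; apply: contrapT => /negP B0; apply: pq0; exact: graph_solution_imaginary S B0.
move: S; rewrite {}B0 {fl} => S.
have A0 : 0 <= A.
  rewrite leNgt; apply/negP => A0; apply: pq0 => j x xL.
  by have [_ _] := graph_solution_energy S (ltW A0) j xL; apply; rewrite lt_eqF.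
have [->|An0] := eqVneq A 0; [by left|right].
have Ap : 0 < A by rewrite lt_neqAle eq_sym An0.
have m0 : 0 < Num.sqrt A by rewrite sqrtr_gt0.
set m := Num.sqrt A in m0.
have AE : A = m ^+ 2 by rewrite sqr_sqrtr.
have mn0 : m != 0 by rewrite gt_eqF.
have dr j x : x \in `]0, L[ -> has_derive (r j) x (- (m ^+ 2 * p j x)).
  by move=> xL; apply: has_derive_eq (sol_dr S j xL) _; rewrite AE mul0r subr0.
have ds j x : x \in `]0, L[ -> has_derive (s j) x (- (m ^+ 2 * q j x)).
  by move=> xL; apply: has_derive_eq (sol_ds S j xL) _; rewrite AE mul0r addr0.
have [al [be [_ pE sp]]] := kirchhoff_oscillators mn0 (sol_p_cont S) (sol_r_cont S)
  (sol_dp S) dr (sol_p0 S) (sol_pL S) (sol_r0 S) (sol_rL S).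
have [al' [be' [_ qE sq]]] := kirchhoff_oscillators mn0 (sol_q_cont S) (sol_s_cont S)
  (sol_dq S) ds (sol_q0 S) (sol_qL S) (sol_s0 S) (sol_sL S).
have sL : sin (m * L) = 0.
  apply/eqP; apply: contrapT => /negP sL; apply: pq0 => j x xL.
  have [al0 be0] := sp sL; have [al'0 be'0] := sq sL.
  rewrite pE ?qE; [|exact: in_edge_cc|exact: in_edge_cc].
  by rewrite /trig_wave al0 be0 al'0 be'0 !mul0r addr0.
have [k k1 kE] := sin_eq0_gt0 (mulr_gt0 m0 (edge_length_gt0 R)) sL.
exists k; split=> //; rewrite /lambda AE complexr0; congr ((_ ^+ 2)%:C).
apply: (mulIf (x := L)); first by rewrite gt_eqF// edge_length_gt0.
by rewrite kE; field.
Qed.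

(** The first vector of a free family is not zero. *)
Lemma eigenbasis_eigenvalue l n (b : 'I_n.+1 -> graph_function R) :
  eigenbasis_H0 l b -> eigenvalue_H0 l.
Proof.
move=> [bl free _]; exists (b ord0); split=> // b0.
have := free (fun i => (i == ord0)%:R) _ ord0.
rewrite eqxx => H; suff /H/eqP : eq_L2G (lincomb (fun i => (i == ord0)%:R) b) (fun _ _ => 0).
  by rewrite oner_eq0.
rewrite (_ : lincomb _ b = b ord0)//; apply/funext => j; apply/funext => x.
rewrite /lincomb (bigD1 ord0)//= mul1r big1 ?addr0// => i /negbTE ->.
by rewrite mul0r.
Qed.

Lemma eigenbasis_zero : eigenbasis_H0 0 (fun _ : 'I_1 => phi0 R).
Proof.
split.
- move=> _; rewrite (_ : 0 = (0 ^+ 2 : R)%:C); last by rewrite expr0n.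
  rewrite phi0_trig; apply: trig_function_eigenspace; first by rewrite mul0r sin0.
  by rewrite big1.
- move=> a a0 i; rewrite (ord1 i).
  have aE : lincomb a (fun _ : 'I_1 => phi0 R) ord0 = fun=> a ord0.
    by apply/funext => x; rewrite /lincomb big_ord1 mulr1.
  apply: (@eq_L2_zero R (fun=> a ord0) _ _ 0).
  + by split; exact: segment_continuous_cst.
  + by rewrite -aE; exact: a0.
  + by rewrite in_itv /= lexx ltW// edge_length_gt0.
- move=> f fl.
  have [p [q [r [s [S fpq]]]]] := eigenspace_graph_solution (A := 0) (B := 0) fl.
  have cp := sol_p_cont S; have cq := sol_q_cont S.
  have rs j x (xL : x \in `]0, L[) := graph_solution_energy S (lexx 0) j xL.
  have pc j x : x \in `[0, L] -> p j x = p ord0 0.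
    move=> xL; rewrite (sol_p0 S ord0 j).
    apply: (zero_derivative_cst (cp j) _ xL).
    by move=> y yL; apply: has_derive_eq (sol_dp S j yL) _; case: (rs j y yL).
  have qc j x : x \in `[0, L] -> q j x = q ord0 0.
    move=> xL; rewrite (sol_q0 S ord0 j).
    apply: (zero_derivative_cst (cq j) _ xL).
    by move=> y yL; apply: has_derive_eq (sol_dq S j yL) _; case: (rs j y yL).
  exists (fun=> p ord0 0 +i* q ord0 0) => j.
  apply: filterS (fpq j) => x fx xL; rewrite fx// /lincomb big_ord1 mulr1.
  by rewrite pc ?qc//; exact: in_edge_cc.
Qed.

Lemma lincomb_triple (a : 'I_3 -> R[i]) (b1 b2 b3 : graph_function R) j x :
  lincomb a (fun i => tnth [tuple b1; b2; b3] i) j x =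
  a ord0 * b1 j x + a (lift ord0 ord0) * b2 j x
    + a (lift ord0 (lift ord0 ord0)) * b3 j x.
Proof.
by rewrite /lincomb !big_ord_recl big_ord0 addr0 addrA !(tnth_nth b1).
Qed.

Lemma complex_mul_real (z : R[i]) (t : R) :
  z * t%:C = (complex.Re z * t) +i* (complex.Im z * t).
Proof. by case: z => a b; apply/eqP; rewrite eq_complex /= !mulr0 subr0 add0r !eqxx. Qed.

(** Freeness: evaluate at 0, where only the cosine survives, then at pi / k,
    where the cosine vanishes and the sine is 1, on the second and third edges.
    Spanning: the sine coefficients have zero sum, so the one of the first edge
    is minus the sum of the two others, as in the two sine families. *)
Lemma eigenbasis_lambda k : (1 <= k)%N ->
  eigenbasis_H0 (lambda R k)
    (fun i : 'I_3 => tnth [tuple phi1 R k; phi2 R k; phi3 R k] i).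
Proof.
move=> k1; have k0 : k%:R != 0 :> R by rewrite pnatr_eq0 -lt0n.
rewrite phi1_trig phi2_trig phi3_trig.
set m := k%:R / 2.
have m0 : m != 0 by rewrite mulf_neq0// invr_neq0.
have sL : sin (m * L) = 0.
  by rewrite (_ : m * L = k%:R * pi) ?sin_natmul_pi// /m; field.
pose T1 := trig_wave m 1 (fun=> 0).
pose T2 := trig_wave m 0 (@sine_sign2 R).
pose T3 := trig_wave m 0 (@sine_sign3 R).
split.
- move=> i; case: i => [[|[|[|//]]] ij]; rewrite (tnth_nth (phi0 R)) /=;
    apply: trig_function_eigenspace => //.
  + by rewrite big1.
  + by rewrite !big_ord_recl big_ord0 /sine_sign2 !(tnth_nth 0) /=; ring.
  + by rewrite !big_ord_recl big_ord0 /sine_sign3 !(tnth_nth 0) /=; ring.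
- move=> a a0.
  have {}a0 j x : x \in `[0, L] ->
      a ord0 * (T1 j x)%:C + a (lift ord0 ord0) * (T2 j x)%:C +
      a (lift ord0 (lift ord0 ord0)) * (T3 j x)%:C = 0.
    move: x; apply: eq_L2_zero; last first.
      rewrite (_ : (fun x => _) = lincomb a (fun i : 'I_3 => tnth
        [tuple trig_function m 1 (fun=> 0); trig_function m 0 (@sine_sign2 R);
          trig_function m 0 (@sine_sign3 R)] i) j); first exact: a0.
      by apply/funext => x; rewrite lincomb_triple.
    have cT c t (al : R) be : segment_continuous 0 L (fun x => c * trig_wave m al be t x).
      by apply: segment_continuousZ; exact: trig_wave_continuous.
    split.
      rewrite (_ : (fun x => _) = fun x => complex.Re (a ord0) * T1 j x +
        complex.Re (a (lift ord0 ord0)) * T2 j x +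
        complex.Re (a (lift ord0 (lift ord0 ord0))) * T3 j x).
        by apply: segment_continuousD; [apply: segment_continuousD|]; exact: cT.
      by apply/funext => x; rewrite !complex_mul_real.
    rewrite (_ : (fun x => _) = fun x => complex.Im (a ord0) * T1 j x +
      complex.Im (a (lift ord0 ord0)) * T2 j x +
      complex.Im (a (lift ord0 (lift ord0 ord0))) * T3 j x).
      by apply: segment_continuousD; [apply: segment_continuousD|]; exact: cT.
    by apply/funext => x; rewrite !complex_mul_real.
  have L0 : 0 \in `[0, L] by rewrite in_itv /= lexx ltW// edge_length_gt0.
  have a1 : a ord0 = 0.
    have := a0 ord0 0 L0; rewrite /T1 /T2 /T3 /trig_wave !mulr0 cos0 sin0 !mulr0 !addr0 !mulr1.
    by rewrite !mulr0 !addr0.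
  (* m * y is a right angle *)
  pose y : R := pi / k%:R.
  have yL : y \in `[0, L].
    rewrite in_itv /= /y divr_ge0 ?pi_ge0//= ler_pdivrMr ?ltr0n//.
    rewrite mulrAC ler_peMl ?pi_ge0// -[1]/(1%:R) -natrM ler_nat.
    by rewrite (leq_trans _ (leq_mul (leqnn 2) k1)).
  have my : m * y = pi / 2 by rewrite /m /y; field.
  have Ty al be j : trig_wave m al be j y = be j.
    by rewrite /trig_wave my cos_pihalf sin_pihalf mulr0 add0r mulr1.
  have a2 : a (lift ord0 ord0) = 0.
    have := a0 (lift ord0 ord0) y yL; rewrite /T1 /T2 /T3 !Ty a1
      /sine_sign2 /sine_sign3 !(tnth_nth 0) /=.
    by rewrite mul0r mulr0 add0r addr0 mulr1.
  have a3 : a (lift ord0 (lift ord0 ord0)) = 0.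
    have := a0 (lift ord0 (lift ord0 ord0)) y yL.
    rewrite /T1 /T2 /T3 !Ty a1
      /sine_sign2 /sine_sign3 !(tnth_nth 0) /=.
    by rewrite mul0r mulr0 !add0r mulr1.
  case=> [[|[|[|//]]] ij].
  + by rewrite -[RHS]a1; congr a; apply/val_inj.
  + by rewrite -[RHS]a2; congr a; apply/val_inj.
  + by rewrite -[RHS]a3; congr a; apply/val_inj.
- move=> f fl.
  have [p [q [r [s [S fpq]]]]] := eigenspace_graph_solution (A := m ^+ 2) (B := 0) fl.
  have dr j x : x \in `]0, L[ -> has_derive (r j) x (- (m ^+ 2 * p j x)).
    by move=> xL; apply: has_derive_eq (sol_dr S j xL) _; rewrite mul0r subr0.
  have ds j x : x \in `]0, L[ -> has_derive (s j) x (- (m ^+ 2 * q j x)).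
    by move=> xL; apply: has_derive_eq (sol_ds S j xL) _; rewrite mul0r addr0.
  have [al [be [be0 pE _]]] := kirchhoff_oscillators m0 (sol_p_cont S) (sol_r_cont S)
    (sol_dp S) dr (sol_p0 S) (sol_pL S) (sol_r0 S) (sol_rL S).
  have [al' [be' [be'0 qE _]]] := kirchhoff_oscillators m0 (sol_q_cont S) (sol_s_cont S)
    (sol_dq S) ds (sol_q0 S) (sol_qL S) (sol_s0 S) (sol_sL S).
  pose i1 : 'I_3 := lift ord0 ord0; pose i2 : 'I_3 := lift ord0 (lift ord0 ord0).
  pose a := fun i => tnth [tuple al +i* al'; be i1 +i* be' i1; be i2 +i* be' i2] i.
  have wave c g (j : 'I_3) x : \sum_i g i = 0 -> trig_wave m c g j x =
      c * T1 j x + g i1 * T2 j x + g i2 * T3 j x.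
    rewrite !big_ord_recl big_ord0 addr0 => /eqP; rewrite addr_eq0 => /eqP g0.
    rewrite /T1 /T2 /T3 /trig_wave /sine_sign2 /sine_sign3 !(tnth_nth 0).
    case: j => [[|[|[|//]]] ij] /=.
    + rewrite (_ : Ordinal ij = ord0); last exact/val_inj.
      by rewrite g0 -/i1 -/i2; ring.
    + by rewrite (_ : Ordinal ij = i1); [ring|exact/val_inj].
    + by rewrite (_ : Ordinal ij = i2); [ring|exact/val_inj].
  exists a => j; apply: filterS (fpq j) => x fx xL; rewrite fx// lincomb_triple.
  rewrite pE; last exact: in_edge_cc.
  rewrite qE; last exact: in_edge_cc.
  rewrite (wave _ _ _ _ be0) (wave _ _ _ _ be'0).
  by rewrite /a !(tnth_nth 0) /= !complex_mul_real.
Qed.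

End Spectrum.

Theorem proposition4p12 (R : realType) :
  [/\ forall l : R[i], eigenvalue_H0 l <->
        l = 0 \/ exists k : nat, (1 <= k)%N /\ l = lambda R k,
      eigenbasis_H0 0 (fun _ : 'I_1 => phi0 R) &
      forall k : nat, (1 <= k)%N ->
        multiplicity_H0 (lambda R k) 3 /\
        eigenbasis_H0 (lambda R k)
          (fun i : 'I_3 => tnth [tuple phi1 R k; phi2 R k; phi3 R k] i)].
Proof.
split.
- move=> l; split; first exact: eigenvalue_form.
  move=> [->|[k [k1 ->]]]; first exact: eigenbasis_eigenvalue (eigenbasis_zero R).
  exact: eigenbasis_eigenvalue (eigenbasis_lambda R k1).
- exact: eigenbasis_zero.
- move=> k k1; split; last exact: eigenbasis_lambda.
  by eexists; exact: eigenbasis_lambda.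
Qed.
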